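(* Let $X$ be a 2-step compact finite-rank (cfr) nilspace (with a fixed Riemannian metric) and let $\sigma\in(0,1/2)$. Let $Z$ be a finite abelian group, let $\phi:Z\to X$ be a nilspace morphism, and let $F_\chi\circ\phi$ be a 2-step nilspace character on $Z$ with vertical frequency $\chi\in\widehat{Z_2(X)}$, where $F_\chi:X\to\mathbb{C}$ is a 1-bounded Lipschitz function with vertical frequency $\chi$. Then, for every $h\in Z$, we have $\Delta_h(F_\chi\circ\phi)(z)=\sum_{\gamma\in S_h}\lambda_{h,\gamma}\gamma(z)+\mathcal{E}_h(z)$ for all $z\in Z$, where $S_h\subset\widehat{Z}$ satisfies $|S_h|=O_{X,\|F_\chi\|_{\mathrm{sum}}}(\sigma^{-O_X(1)})$, the function $\mathcal{E}_h:Z\to\mathbb{C}$ satisfies $\|\mathcal{E}_h\|_\infty\le\sigma$, and for all $h\in Z$ and $\gamma\in S_h$ the number $\lambda_{h,\gamma}\in\mathbb{C}$ satisfies $|\lambda_{h,\gamma}|\le\|F_\chi\|_\infty^2$.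
   Context: Nilspaces. A cube morphism $\{0,1\}^m\to\{0,1\}^n$ is the restriction of an affine homomorphism $\mathbb{Z}^m\to\mathbb{Z}^n$. A nilspace is a set $X$ with sets $C^n(X)\subset X^{\{0,1\}^n}$, $n\ge0$ ($n$-cubes), such that: $c\circ\psi\in C^m(X)$ for every $c\in C^n(X)$ and cube morphism $\psi:\{0,1\}^m\to\{0,1\}^n$; $C^1(X)=X^{\{0,1\}}$; and any $c':\{0,1\}^n\setminus\{1^n\}\to X$ whose restriction to each face $\{v:v_i=0\}$ is an $(n-1)$-cube extends to an $n$-cube. It is $k$-step if this extension is unique for $n=k+1$. A morphism of nilspaces is a map sending cubes to cubes by composition. For an abelian group $A$ and $j\ge1$, $\mathcal{D}_j(A)$ is the nilspace on $A$ whose $n$-cubes are the maps $c:\{0,1\}^n\to A$ with $\sum_{v\in\{0,1\}^{j+1}}(-1)^{|v|}c(\psi(v))=0$ for all cube morphisms $\psi:\{0,1\}^{j+1}\to\{0,1\}^n$. A finite abelian group $Z$ is viewed as the nilspace $\mathcal{D}_1(Z)$, whose $n$-cubes are the maps $v\mapsto x+v_1t_1+\cdots+v_nt_n$. A compact nilspace is a nilspace with a compact Hausdorff second-countable topology for which every $C^n(X)$ is closed. Structure groups. For a $k$-step compact nilspace $X$ let $x\sim_jy$ iff there are $c,c'\in C^{j+1}(X)$ with $c(0)=x$, $c'(0)=y$ and $c=c'$ elsewhere; $X_j=X/\sim_j$ ($X_k=X$, $X_0$ a point). There are compact abelian groups $Z_j(X)$ (structure groups), $1\le j\le k$, with $Z_j(X)$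 acting freely and continuously on $X_j$, the orbits being the fibres of $X_j\to X_{j-1}$, and such that for $c\in C^n(X_j)$ the cubes in $C^n(X_j)$ with the same image in $X_{j-1}$ as $c$ are exactly $c+d$, $d\in C^n(\mathcal{D}_j(Z_j(X)))$. The action of $z\in Z_k(X)$ on $x\in X$ is written $x+z$. $X$ has finite rank (cfr nilspace) if all $Z_j(X)$ are compact abelian Lie groups. Metrics. A $k$-step cfr nilspace is isomorphic to a quotient $F/H$ of a free nilspace $F=\prod_{i=1}^k\mathcal{D}_i(\mathbb{Z}^{a_i}\times\mathbb{R}^{b_i})$ by a $k$-th order lattice action $H$, and is a compact smooth manifold with the smooth structure making $F\to F/H$ a submersion. It is equipped with a Riemannian metric tensor and the distance $d(x,y)$ = geodesic distance if $x,y$ lie in the same connected component, and $1$ otherwise. For $F:X\to\mathbb{C}$, $\|F\|_L$ is its (optimal) Lipschitz constant and $\|F\|_{\mathrm{sum}}=\|F\|_L+\|F\|_\infty$. A function $F:X\to\mathbb{C}$ on a $k$-step compact nilspace has vertical frequency $\chi\in\widehat{Z_k(X)}$ if $F(x+z)=\chi(z)F(x)$ for all $x\in X$, $z\in Z_k(X)$. A $k$-step nilspace character on $Z$ is a function $F_\chi\circ\phi$ where $\phi:Z\to X$ is a morphism into a $k$-step cfr nilspace and $F_\chi:X\to\mathbb{C}$ is 1-bounded, continuous, with vertical frequency $\chi$. Write $\Delta_hg(z)=g(z+h)\overline{g(z)}$. $\widehat{Z}$ is the dual group. The implied constants in $O$-notation depend only on the indicated subscripts (and on the fixed metric on $X$).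 *)

(* Defs.v *)
From HB Require Import structures.
From mathcomp Require Import all_boot all_order all_algebra.
From mathcomp Require Import all_classical all_reals all_analysis.
From mathcomp Require Import finmap complex.

Set Implicit Arguments.
Unset Strict Implicit.
Unset Printing Implicit Defensive.

Import Order.TTheory GRing.Theory Num.Theory.
Import numFieldNormedType.Exports.

Local Open Scope classical_set_scope.
Local Open Scope ring_scope.

(** * Nilspaces *)

Definition cube (n : nat) := {ffun 'I_n -> bool}.

Definition cube0 n : cube n := [ffun => false].
Definition cube1 n : cube n := [ffun => true].

Definition cube_weight n (v : cube n) : nat := (\sum_(i < n) v i)%N.

Definition cube_morphism m n (psi : cube m -> cube n) : Prop :=
  exists (A : 'I_n -> 'I_m -> int) (b : 'I_n -> int),
    forall (v : cube m) (i : 'I_n),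
      (psi v i : nat)%:Z = b i + \sum_(j < m) A i j * (v j : nat)%:Z.

Definition cube_family (X : Type) := forall n : nat, set (cube n -> X).

(* The inclusion of the face {v | v i = 0} of the (n+1)-cube, identified with
   the n-cube. *)
Definition face0 n (i : 'I_n.+1) (v : cube n) : cube n.+1 :=
  [ffun j => if unlift i j is Some k then v k else false].

(* Corners are represented by total functions on the cube whose value at 1^n
   is irrelevant: no face {v | v i = 0} contains 1^n.  *)
Definition is_corner (X : Type) (C : cube_family X) n (c : cube n.+1 -> X) :=
  forall i : 'I_n.+1, C n (c \o face0 i).

Record is_nilspace (X : Type) (C : cube_family X) : Prop := IsNilspace {
  nil_comp : forall m n (c : cube n -> X) (psi : cube m -> cube n),
    C n c -> cube_morphism psi -> C m (c \o psi) ;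
  nil_edge : C 1%N = setT ;
  nil_corner : forall n (c' : cube n.+1 -> X), is_corner C c' ->
    exists2 c, C n.+1 c & forall v, v != cube1 n.+1 -> c v = c' v }.

Definition is_step (X : Type) (C : cube_family X) (k : nat) : Prop :=
  forall c c' : cube k.+1 -> X, C k.+1 c -> C k.+1 c' ->
    (forall v, v != cube1 k.+1 -> c v = c' v) -> c = c'.

Definition nil_morphism (X Y : Type) (C : cube_family X) (D : cube_family Y)
    (phi : X -> Y) : Prop :=
  forall n (c : cube n -> X), C n c -> D n (phi \o c).

Definition Dcubes (j : nat) (A : zmodType) : cube_family A := fun n =>
  [set c : cube n -> A | forall psi : cube j.+1 -> cube n, cube_morphism psi ->
    \sum_(v : cube j.+1) c (psi v) *~ (-1) ^+ cube_weight v = 0].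

Definition prod_cubes (X Y : Type) (C : cube_family X) (D : cube_family Y) :
    cube_family (X * Y) := fun n =>
  [set c : cube n -> X * Y | C n (fst \o c) /\ D n (snd \o c)].

Definition image_cubes (X Y : Type) (p : X -> Y) (C : cube_family X) :
    cube_family Y := fun n => [set p \o c | c in C n].

(* Translations of height i: applying alpha on a face of codimension i (here
   the face where v agrees with b on J) preserves cubes. *)
Definition translation (X : Type) (C : cube_family X) (i : nat)
    (alpha : X -> X) : Prop :=
  forall n (c : cube n -> X) (J : {set 'I_n}) (b : cube n),
    C n c -> #|J| = i ->
    C n (fun v => if [forall (j | j \in J), v j == b j]
                  then alpha (c v) else c v).

Record is_compact_nilspace (X : topologicalType) (C : cube_family X) : Prop :=
  IsCompactNilspace {
  cnil_nil : is_nilspace C ;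
  cnil_compact : compact [set: X] ;
  cnil_hausdorff : hausdorff_space X ;
  cnil_countable : @second_countable X ;
  cnil_closed : forall n, @closed {ptws cube n -> X} (C n) }.

(** * Smooth maps and compact abelian Lie groups *)

Section Smooth.
Variable R : realType.

Fixpoint Ck_on (V W : normedModType R) (k : nat) (U : set V) (f : V -> W) :
    Prop :=
  (forall x, U x -> {for x, continuous f}) /\
  (if k is k'.+1 then
     forall v, (forall x, U x -> derivable f x v) /\
               Ck_on k' U (fun x => 'D_v f x)
   else True).

(* Only used for an open set U. *)
Definition smooth_on (V W : normedModType R) (U : set V) (f : V -> W) : Prop :=
  forall k, Ck_on k U f.

Record chart (M : Type) (n : nat) := Chart {
  chart_dom : set M ;
  chart_to : M -> 'rV[R]_n ;
  chart_of : 'rV[R]_n -> M }.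

Definition chart_im M n (c : chart M n) : set 'rV[R]_n :=
  chart_to c @` chart_dom c.

Definition is_chart (M : topologicalType) n (c : chart M n) : Prop :=
  [/\ open (chart_dom c), open (chart_im c),
      forall x, chart_dom c x -> chart_of c (chart_to c x) = x,
      forall x, chart_dom c x -> {for x, continuous (chart_to c)} &
      forall u, chart_im c u -> {for u, continuous (chart_of c)}].

Definition abelian_Lie_group (Z : topologicalZmodType) : Prop :=
  exists (n : nat) (A : set (chart Z n)),
    [/\ forall c, A c -> is_chart c,
        forall z, exists2 c, A c & chart_dom c z,
        forall c c', A c -> A c' ->
          smooth_on (chart_to c @` (chart_dom c `&` chart_dom c'))
                    (chart_to c' \o chart_of c) &
        forall c1 c2 c3, A c1 -> A c2 -> A c3 ->
          let sub (u : 'rV[R]_(n + n)) :=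
            chart_of c1 (lsubmx u) - chart_of c2 (rsubmx u) in
          smooth_on [set u | [/\ chart_im c1 (lsubmx u),
                                 chart_im c2 (rsubmx u) &
                                 chart_dom c3 (sub u)]]
                    (chart_to c3 \o sub)].

End Smooth.

(** * Compact finite-rank nilspaces of step 2 *)

Definition vert_equiv (X : Type) (C : cube_family X) (j : nat) (x y : X) :
    Prop :=
  exists c c' : cube j.+1 -> X,
    [/\ C j.+1 c, C j.+1 c', c (cube0 _) = x, c' (cube0 _) = y &
        forall v, v != cube0 _ -> c v = c' v].

(* p : X -> Y is, up to isomorphism, the projection of X onto
   X_j = X / ~_j with the quotient topology; the cubes of X_j are
   [image_cubes p C]. *)
Record is_factor (X Y : topologicalType) (C : cube_family X) (j : nat)
    (p : X -> Y) : Prop := IsFactor {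
  factor_surj : forall y, exists x, p x = y ;
  factor_equiv : forall x x', p x = p x' <-> vert_equiv C j x x' ;
  factor_open : forall U : set Y, open U <-> open (p @^-1` U) }.

(* The compact abelian group Z, acting on Y = X_j, is the j-th structure group;
   q is the projection of X_j onto Y' = X_(j-1), and C the cubes of X_j. *)
Record is_structure_group (j : nat) (Y : topologicalType) (Y' : Type)
    (C : cube_family Y) (q : Y -> Y') (Z : topologicalZmodType)
    (act : Y -> Z -> Y) : Prop := IsStructureGroup {
  sg_compact : compact [set: Z] ;
  sg_hausdorff : hausdorff_space Z ;
  sg_act0 : forall y, act y 0 = y ;
  sg_actD : forall y z z', act y (z + z') = act (act y z) z' ;
  sg_free : forall y z, act y z = y -> z = 0 ;
  sg_continuous : continuous (fun yz : Y * Z => act yz.1 yz.2) ;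
  sg_orbit : forall y y', q y = q y' <-> exists z, y' = act y z ;
  sg_cubes : forall n (c : cube n -> Y), C n c -> forall c' : cube n -> Y,
    (C n c' /\ q \o c' = q \o c) <->
    (exists2 d : cube n -> Z, Dcubes j d &
       c' = (fun v => act (c v) (d v))) }.

(* A 2-step cfr nilspace X = X_2, with its factor X_1 and its structure groups
   (these are unique up to isomorphism); X_0 is the one-point space. *)
Record cfr_nilspace2 (R : realType) := CfrNilspace2 {
  cfr_space :> topologicalType ;
  cfr_cubes : cube_family cfr_space ;
  cfr_factor1 : topologicalType ;
  cfr_proj1 : cfr_space -> cfr_factor1 ;
  cfr_Z1 : topologicalZmodType ;
  cfr_Z2 : topologicalZmodType ;
  cfr_act1 : cfr_factor1 -> cfr_Z1 -> cfr_factor1 ;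
  cfr_act2 : cfr_space -> cfr_Z2 -> cfr_space ;
  cfr_compact_nilspace : is_compact_nilspace cfr_cubes ;
  cfr_step : is_step cfr_cubes 2 ;
  cfr_factor : is_factor cfr_cubes 1 cfr_proj1 ;
  cfr_group1 : is_structure_group 1 (image_cubes cfr_proj1 cfr_cubes)
                 (fun _ => tt) cfr_act1 ;
  cfr_group2 : is_structure_group 2 cfr_cubes cfr_proj1 cfr_act2 ;
  cfr_Lie1 : abelian_Lie_group R cfr_Z1 ;
  cfr_Lie2 : abelian_Lie_group R cfr_Z2 }.

Arguments cfr_cubes {R} c n.

(** * Free nilspaces and lattice actions *)

Definition free_group (R : realType) (a b : nat) : Type :=
  ('rV[int]_a * 'rV[R]_b)%type.

HB.instance Definition _ (R : realType) (a b : nat) :=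
  GRing.Zmodule.copy (free_group R a b) ('rV[int]_a * 'rV[R]_b)%type.
HB.instance Definition _ (R : realType) (a b : nat) :=
  Topological.copy (free_group R a b)
    (discrete_topology 'rV[int]_a * 'rV[R]_b)%type.

Definition is_lattice (A : PreTopologicalZmodule.type) (G : set A) : Prop :=
  [/\ G 0,
      forall x y, G x -> G y -> G (x - y),
      exists2 U, nbhs (0 : A) U & G `&` U `<=` [set 0] &
      exists2 K, compact K &
        forall x, exists g k, [/\ G g, K k & x = g + k]].

Section FreeNilspace.
Variables (R : realType) (a1 b1 a2 b2 : nat).

Definition free2 : Type := (free_group R a1 b1 * free_group R a2 b2)%type.

HB.instance Definition _ := Topological.copy free2
  (free_group R a1 b1 * free_group R a2 b2)%type.

Definition free_cubes : cube_family free2 :=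
  prod_cubes (Dcubes 1 (A := free_group R a1 b1))
             (Dcubes 2 (A := free_group R a2 b2)).

(* Lattice actions of order 2: H is a group of continuous translations of the
   free nilspace, fibre-transitive over the first component, and inducing a
   lattice on each of the two components. *)
Record lattice_action2 (H : set (free2 -> free2)) : Prop := LatticeAction2 {
  la_id : H id ;
  la_comp : forall h g, H h -> H g -> H (h \o g) ;
  la_inv : forall h, H h -> exists2 g, H g & cancel h g /\ cancel g h ;
  la_continuous : forall h, H h -> continuous h ;
  la_translation : forall h, H h -> translation free_cubes 1 h ;
  la_fibre_transitive : forall h p, H h -> (h p).1 = p.1 ->
    exists g, [/\ H g, translation free_cubes 2 g & g p = h p] ;
  la_lattice1 : is_lattice
    [set s : free_group R a1 b1 |
      exists2 h, H h & forall p, (h p).1 = p.1 + s] ;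
  la_lattice2 : is_lattice
    [set t : free_group R a2 b2 |
      exists2 h, H h & forall p, h p = (p.1, p.2 + t)] }.

(* The real coordinates of a point, and the chart of the free nilspace (a
   disjoint union of copies of R^(b1 + b2)) centred at a point. *)
Definition free_real (p : free2) : 'rV[R]_(b1 + b2) := row_mx p.1.2 p.2.2.

Definition free_shift (p : free2) (u : 'rV[R]_(b1 + b2)) : free2 :=
  ((p.1.1, p.1.2 + lsubmx u), (p.2.1, p.2.2 + rsubmx u)).

Definition free_diff (h : free2 -> free2) (p : free2) (u : 'rV[R]_(b1 + b2)) :
    'rV[R]_(b1 + b2) :=
  'D_u (fun w => free_real (h (free_shift p w))) (0 : 'rV[R]_(b1 + b2)).

End FreeNilspace.

Arguments free_cubes : clear implicits.

(* An isomorphism of X with the quotient F / H of a free nilspace by a lattice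
   action, given as the resulting projection F -> X. *)
Record free_presentation (R : realType) (X : cfr_nilspace2 R) :=
  FreePresentation {
  fp_a1 : nat ; fp_b1 : nat ; fp_a2 : nat ; fp_b2 : nat ;
  fp_H : set (free2 R fp_a1 fp_b1 fp_a2 fp_b2 ->
              free2 R fp_a1 fp_b1 fp_a2 fp_b2) ;
  fp_proj : free2 R fp_a1 fp_b1 fp_a2 fp_b2 -> X ;
  fp_action : lattice_action2 fp_H ;
  fp_surj : forall x, exists p, fp_proj p = x ;
  fp_orbit : forall p q,
    fp_proj p = fp_proj q <-> (exists2 h, fp_H h & q = h p) ;
  fp_open : forall U : set X, open U <-> open (fp_proj @^-1` U) ;
  fp_cubes : cfr_cubes X =
    image_cubes fp_proj (free_cubes R fp_a1 fp_b1 fp_a2 fp_b2) }.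

(** * Riemannian metrics and geodesic distance *)

Section Riemannian.
Variables (R : realType) (X : cfr_nilspace2 R) (P : free_presentation X).

Local Notation F := (free2 R (fp_a1 P) (fp_b1 P) (fp_a2 P) (fp_b2 P)).
Local Notation V := 'rV[R]_(fp_b1 P + fp_b2 P).

(* The group acts discretely, so F -> X is a local homeomorphism, and the smooth
   structure on X for which it is a submersion is the one whose charts are the
   local inverses of F -> X. The matrix g p is the expression of the metric
   tensor at the image of p in the chart around p; changes of charts are
   given by the elements of the group. *)
Record riemannian_metric := RiemannianMetric {
  rm_tensor : F -> 'M[R]_(fp_b1 P + fp_b2 P) ;
  rm_smooth : forall p i j,
    smooth_on setT (fun u : V => rm_tensor (free_shift p u) i j) ;
  rm_sym : forall p, (rm_tensor p)^T = rm_tensor p ;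
  rm_pos : forall p (u : V), u != 0 -> 0 < (u *m rm_tensor p *m u^T) 0 0 ;
  rm_invariant : forall h, fp_H h -> forall p (u v : V),
    (free_diff h p u *m rm_tensor (h p) *m (free_diff h p v)^T) 0 0 =
    (u *m rm_tensor p *m v^T) 0 0 }.

Variable g : riemannian_metric.

Definition C1_curve (gamma : R -> V) : Prop :=
  (forall t, derivable gamma t 1) /\ continuous (derive1 gamma).

Definition curve_length (p : F) (gamma : R -> V) : R :=
  \int[lebesgue_measure]_(t in `[0, 1]%classic)
    Num.sqrt ((derive1 gamma t *m rm_tensor g (free_shift p (gamma t))
                 *m (derive1 gamma t)^T) 0 0).

(* pw_curve x y l: there is a piecewise C^1 curve of length l in X from x to y.
   Such a curve is subdivided so that each piece lies in a chart, and is thus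
   the image of a C^1 curve t |-> free_shift p (gamma t) in F, 0 <= t <= 1;
   gamma is taken C^1 on R, as every C^1 curve on [0, 1] extends. *)
Inductive pw_curve : X -> X -> R -> Prop :=
| pw_nil x : pw_curve x x 0
| pw_cons p gamma y l : C1_curve gamma ->
    pw_curve (fp_proj (free_shift p (gamma 1))) y l ->
    pw_curve (fp_proj (free_shift p (gamma 0))) y (curve_length p gamma + l).

Definition rdist (x y : X) : R :=
  if `[< connected_component [set: X] x y >] then inf [set l | pw_curve x y l]
  else 1.

End Riemannian.

(** * Complex-valued functions, characters *)

Section Functions.
Variable R : realType.

Definition cnorm (z : R[i]) : R := Normc.normc z.

Definition norm_sup (X : Type) (f : X -> R[i]) : R :=
  sup (range (fun x => cnorm (f x))).

Definition lipschitz_bounds (X : Type) (d : X -> X -> R) (f : X -> R[i]) :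
    set R :=
  [set L | 0 <= L /\ forall x y, cnorm (f x - f y) <= L * d x y].

Definition is_lipschitz (X : Type) (d : X -> X -> R) (f : X -> R[i]) : Prop :=
  lipschitz_bounds d f !=set0.

Definition norm_lip (X : Type) (d : X -> X -> R) (f : X -> R[i]) : R :=
  inf (lipschitz_bounds d f).

Definition norm_sum (X : Type) (d : X -> X -> R) (f : X -> R[i]) : R :=
  norm_lip d f + norm_sup f.

Definition is_character (A : zmodType) (chi : A -> R[i]) : Prop :=
  (forall x y, chi (x + y) = chi x * chi y) /\ (forall x, cnorm (chi x) = 1).

Definition cts (X : topologicalType) (f : X -> R[i]) : Prop :=
  continuous (f : X -> R[i]^o).

Definition vertical_frequency (X : cfr_nilspace2 R) (chi : cfr_Z2 X -> R[i])
    (f : X -> R[i]) : Prop :=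
  forall (x : X) (z : cfr_Z2 X), f (cfr_act2 x z) = chi z * f x.

Definition Delta (Z : zmodType) (h : Z) (f : Z -> R[i]) (z : Z) : R[i] :=
  f (z + h) * (f z)^*.

End Functions.

(* Main.v *)
Require Import Defs.
From HB Require Import structures.
From mathcomp Require Import all_boot all_order all_algebra.
From mathcomp Require Import all_classical all_reals all_analysis.
From mathcomp Require Import finmap complex.
From mathcomp Require Import ssrAC ring lra zify.

(** The derivative [f = Delta h (F \o phi)] is approximated by a short character
    sum as soon as [Z] is coloured with few colours so that translates of [f] by
    elements of the same colour are uniformly close.  Indeed, if [B] is a large
    colour class, averaging [f] over [B - B] changes it little and multiplies
    its Fourier coefficients by [|mu_B^|^2 <= 1]; since these weights sum to
    [|Z| / |B|], the coefficients of [f] below [delta] contribute at most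
    [delta |Z| / |B|], and by Parseval at most [delta^-2] coefficients remain.

    For the colouring, write [X] as a quotient of a free nilspace, and choose
    lifts [p] of [phi y] and [q] of [phi (y + h)] whose first coordinates, and
    whose difference of second coordinates, lie in fixed compact sets; the
    colour of [y] is the cell of these three elements in a grid of mesh [eta].
    If [y] and [y'] have the same colour, the image under [phi] of the 3-cube
    with vertices [y], [y'], [y + z], [y' + z] and their translates by [h] lifts
    to a cube of the free nilspace through the four chosen lifts (the
    translations of the lattice action move one face of codimension 1 or 2 at a
    time).  Its remaining edges, above [y + z, y' + z] and
    [y + z + h, y' + z + h], are then small up to a common vertical shift, which
    [f] does not see because [F] has a vertical frequency. *)

Set Implicit Arguments.
Unset Strict Implicit.
Unset Printing Implicit Defensive.

Import Order.TTheory GRing.Theory Num.Theory.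
Import numFieldNormedType.Exports.

Local Open Scope classical_set_scope.
Local Open Scope ring_scope.

(** * Fourier analysis on a finite abelian group *)

Section Fourier.
Variables (C : numClosedFieldType) (Z : finZmodType).
Implicit Types (f : Z -> C) (gamma : {ffun Z -> C}).

Definition unitary_char gamma : Prop :=
  (forall x y, gamma (x + y) = gamma x * gamma y) /\
  (forall x, `|gamma x| = 1).

Definition fourier f gamma : C := #|Z|%:R^-1 * \sum_z f z * (gamma z)^*.

(** The translation operator on row vectors: [u *m shift_mx x] represents the function
    [z |-> u (z + x)]. *)
Definition shift_mx (x : Z) : 'M[C]_#|Z| :=
  \matrix_(i, j) (enum_val i == enum_val j + x)%:R.

Lemma card_zmod_neq0 : (#|Z|%:R : C) != 0.
Proof. by rewrite pnatr_eq0 -lt0n; apply/card_gt0P; exists 0. Qed.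

Lemma shift_mxM x y : shift_mx x *m shift_mx y = shift_mx (x + y).
Proof.
apply/matrixP=> i j; rewrite !mxE.
rewrite (bigD1 (enum_rank (enum_val j + y))) //= big1 => [|k kj].
  by rewrite !mxE !enum_rankK eqxx mulr1 addr0 (addrC x) addrA.
rewrite !mxE; case: (enum_val k =P _) => [e|]; last by rewrite mulr0.
by rewrite -e enum_valK eqxx in kj.
Qed.

Lemma shift_mx_row (u : 'rV[C]_#|Z|) x j :
  (u *m shift_mx x) 0 j = u 0 (enum_rank (enum_val j + x)).
Proof.
rewrite mxE (bigD1 (enum_rank (enum_val j + x))) //= big1 => [|k kj].
  by rewrite !mxE !enum_rankK eqxx mulr1 addr0.
rewrite !mxE; case: (enum_val k =P _) => [e|]; last by rewrite mulr0.
by rewrite -e enum_valK eqxx in kj.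
Qed.

Lemma shift_mx_adjoint x : (shift_mx x ^t* )%sesqui = shift_mx (- x).
Proof.
apply/matrixP=> i j; rewrite !mxE conjC_nat; congr (nat_of_bool _)%:R.
by rewrite -subr_eq eq_sym.
Qed.

(** The adjoint of a translation is the opposite translation and commutes with it, so the spectral
    theorem for normal matrices applies. *)
Lemma shift_mx_diagonalizable x : diagonalizable (shift_mx x).
Proof.
have /orthomx_spectralP Hs : shift_mx x \is normalmx.
  by apply/normalmxP; rewrite shift_mx_adjoint !shift_mxM addrC.
exists (spectralmx (shift_mx x)); first exact: spectral_unit.
apply/diagonalizable_forLR; first exact: spectral_unit.
exists (spectral_diag (shift_mx x)).
by rewrite (mxpoly.conjVmx _ (spectral_unit _)) {1}Hs.
Qed.

(** Non-vanishing at one point propagates to all of [Z]. Then the product of all values of [gamma]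
    equals its own translate by [x], and cancelling it leaves [gamma x ^+ #|Z| = 1]. *)
Lemma norm_char gamma (x0 : Z) : gamma x0 != 0 ->
  (forall x y, gamma (x + y) = gamma x * gamma y) -> forall x, `|gamma x| = 1.
Proof.
move=> g0 gM x.
have gn0 y : gamma y != 0.
  by apply: contraNneq g0 => gy; rewrite -(subrK y x0) gM gy mulr0.
have /esym e : \prod_y gamma y = \prod_y gamma (x + y).
  by rewrite (reindex_inj (addrI x)).
move: e; under eq_bigr do rewrite gM.
rewrite big_split /= prodr_const -[RHS]mul1r => /mulIf.
move=> /(_ _)/eqP-/(_ _)/eqP gn.
have : `|gamma x| ^+ #|Z| = 1.
  by rewrite -normrX gn ?normr1 //; apply/prodf_neq0 => i _.
move/eqP; rewrite pexpr_eq1 //; first by move/eqP.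
by apply/card_gt0P; exists 0.
Qed.

(* The translations of functions on Z commute and are normal, hence they have a
   common eigenbasis; an eigenfunction of all translations is a multiple of a
   character. *)
Lemma dual_basis : exists D : seq {ffun Z -> C},
  [/\ uniq D, forall gamma, gamma \in D -> unitary_char gamma &
      forall f, exists a : {ffun Z -> C} -> C,
        forall z, f z = \sum_(gamma <- D) a gamma * gamma z].
Proof.
have [P Pu /allP Pd] : codiagonalizable [seq shift_mx x | x <- enum Z].
  apply/codiagonalizableP; split=> [A B|A].
    move=> /mapP[x _ ->] /mapP[y _ ->].
    by rewrite /comm_mx !shift_mxM addrC.
  by move=> /mapP[x _ ->]; apply: shift_mx_diagonalizable.
have eig x : exists d, P *m shift_mx x = diag_mx d *m P.
  have /Pd/= /diagonalizable_forPex[d] : shift_mx x \in [seq shift_mx x | x <- enum Z].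
    by apply: map_f; rewrite mem_enum.
  by move/(simmxP Pu) => e; exists d.
(* Row [i] is an eigenvector of every translation; comparing with its value at 0 eliminates the
   eigenvalue. Divided by its entry at 0, the row is therefore multiplicative. *)
have eigP i x z : P i (enum_rank (z + x)) * P i (enum_rank 0) =
    P i (enum_rank x) * P i (enum_rank z).
  have [d e] := eig x.
  have H y : P i (enum_rank (y + x)) = d 0 i * P i (enum_rank y).
    have := congr1 (fun M => row i M 0 (enum_rank y)) e.
    rewrite /= row_mul shift_mx_row enum_rankK mxE => ->.
    by rewrite row_mul row_diag_mx -scalemxAl -rowE !mxE.
  by rewrite H -[x in RHS]add0r H mulrAC.
(* By [eigP], a row vanishing at 0 has all its entries of square zero, which the invertibility of
   [P] forbids. *)
have P0 i : P i (enum_rank 0) != 0.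
  apply/eqP => Pi0.
  have r0 : row i P = 0.
    apply/rowP => j; rewrite !mxE; apply/eqP; rewrite -(enum_valK j).
    set x := enum_val j; have := eigP i x x; rewrite Pi0 mulr0.
    by move/esym/eqP; rewrite mulf_eq0 orbb.
  move: Pu; rewrite -row_free_unit => Pf.
  have := congr1 (mulmxr (pinvmx P)) r0; rewrite /= mul0mx.
  rewrite -row_mul mulmxVp // => /rowP/(_ i); rewrite !mxE eqxx.
  by move/eqP; rewrite oner_eq0.
pose ch i : {ffun Z -> C} := [ffun z => P i (enum_rank z) / P i (enum_rank 0)].
have chP i : unitary_char (ch i).
  have chM x y : ch i (x + y) = ch i x * ch i y.
    have -> : ch i (x + y) = P i (enum_rank y) * P i (enum_rank x)
        / P i (enum_rank 0) / P i (enum_rank 0).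
      by rewrite ffunE -eigP mulfK.
    by rewrite !ffunE; ring.
  split=> //; apply: (@norm_char _ 0) => //.
  by rewrite ffunE divff ?oner_eq0.
exists (undup [seq ch i | i <- enum 'I_#|Z|]); split; first exact: undup_uniq.
  by move=> gamma; rewrite mem_undup => /mapP[i _ ->].
move=> f.
pose u := \row_j f (enum_val j) *m invmx P.
have fE z : f z = \sum_i u 0 i * P i (enum_rank z).
  have := congr1 (fun v : 'rV_#|Z| => v 0 (enum_rank z))
     (mulmxKV Pu (\row_j f (enum_val j))).
  by rewrite /= mxE [RHS]mxE enum_rankK.
(* At this stage several rows might yield the same character, so their coefficients are grouped. *)
exists (fun gamma => \sum_(i | ch i == gamma) u 0 i * P i (enum_rank 0)) => z.
rewrite fE.
under [RHS]eq_bigr do rewrite big_distrl /=.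
rewrite (exchange_big_dep predT) //=; apply: eq_bigr => i _.
rewrite (big_rem (ch i)) /=; last by rewrite mem_undup map_f ?mem_enum.
rewrite eqxx ffunE -mulrA (mulrC (P i _) (_ / _)) divfK //.
rewrite big_seq_cond big1 ?addr0 // => gamma /andP[].
by rewrite mem_rem_uniq ?undup_uniq // !inE => /andP[/negPf + _]; rewrite eq_sym => ->.
Qed.

(** Translating the summation variable by a point [x] where the characters differ multiplies the sum
    by [gamma x * (gamma' x)^*], which is not 1. *)
Lemma char_orthogonal gamma gamma' : unitary_char gamma -> unitary_char gamma' ->
  gamma != gamma' -> \sum_z gamma z * (gamma' z)^* = 0.
Proof.
move=> [gM g1] [gM' g1'] neq.
have [x gx] : exists x, gamma x != gamma' x.
  apply/existsP; apply: contraNT neq; rewrite negb_exists => /forallP H.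
  by apply/eqP/ffunP => x; move: (H x); rewrite negbK => /eqP.
apply/eqP; have : (gamma x * (gamma' x)^* - 1) * \sum_z gamma z * (gamma' z)^* = 0.
  rewrite mulrBl mul1r [X in _ - X](reindex_inj (addrI x)) /= big_distrr /=.
  rewrite -sumrB big1 // => z _.
  by rewrite gM gM' rmorphM /= mulrACA subrr.
move/eqP; rewrite mulf_eq0 => /orP[|//]; rewrite subr_eq0 => /eqP e.
case/eqP: gx.
rewrite -[LHS]mulr1 -(expr1n _ 2) -(g1' x) normCK mulrCA e.
by rewrite mulr1.
Qed.

(** Orthogonality identifies the coefficients of any expansion in the dual basis with the Fourier
    coefficients. *)
Lemma fourier_inversion : exists D : seq {ffun Z -> C},
  [/\ uniq D, forall gamma, gamma \in D -> unitary_char gamma &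
      forall f z, f z = \sum_(gamma <- D) fourier f gamma * gamma z].
Proof.
have [D [Du Dc Db]] := dual_basis; exists D; split=> // f z.
have [a fE] := Db f; rewrite fE big_seq [RHS]big_seq; apply: eq_bigr => g gD.
congr (_ * _); rewrite /fourier.
have gg : \sum_z a g * g z * (g z)^* = a g * #|Z|%:R.
  rewrite (eq_bigr (fun=> a g)) ?sumr_const ?mulr_natr // => x _.
  by rewrite -mulrA -normCK (Dc _ gD).2 expr1n mulr1.
have gg' g' : g' \in rem g D -> \sum_z a g' * g' z * (g z)^* = 0.
  rewrite mem_rem_uniq // inE => /andP[g'g g'D].
  have := congr1 ( *%R (a g')) (char_orthogonal (Dc _ g'D) (Dc _ gD) g'g).
  rewrite mulr0 big_distrr /=; apply: etrans.
  by apply: eq_bigr => x _; rewrite mulrA.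
under eq_bigr do rewrite fE big_distrl /=.
rewrite exchange_big /= (big_rem g) //= gg [X in _ + X]big_seq big1 ?addr0 //.
by rewrite mulrC mulfK ?card_zmod_neq0.
Qed.

(** Expand one of the two factors of the squared modulus of [f z] and exchange the sums: the inner
    sum is a conjugate Fourier coefficient. *)
Lemma fourier_parseval (D : seq {ffun Z -> C}) f :
  (forall z, f z = \sum_(gamma <- D) fourier f gamma * gamma z) ->
  \sum_(gamma <- D) `|fourier f gamma| ^+ 2 = #|Z|%:R^-1 * \sum_z `|f z| ^+ 2.
Proof.
move=> fE.
have -> : \sum_z `|f z| ^+ 2 =
    \sum_(gamma <- D) fourier f gamma * (\sum_z f z * (gamma z)^*)^*.
  rewrite (eq_bigr (fun z => \sum_(gamma <- D) fourier f gamma * gamma z * (f z)^*)).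
    rewrite exchange_big /=; apply: eq_bigr => g _.
    rewrite rmorph_sum big_distrr /=; apply: eq_bigr => z _.
    by rewrite rmorphM /= conjCK; ring.
  by move=> z _; rewrite normCK {1}fE big_distrl.
rewrite big_distrr /=; apply: eq_bigr => g _.
by rewrite normCK {2}/fourier rmorphM /= fmorphV rmorph_nat; ring.
Qed.

Lemma fourier_bound f gamma M : unitary_char gamma ->
  (forall z, `|f z| <= M) -> `|fourier f gamma| <= M.
Proof.
move=> [_ g1] fM; rewrite /fourier normrM normfV normr_nat.
rewrite ler_pdivrMl ?lt_def ?card_zmod_neq0 ?ler0n //.
rewrite mulr_natl; apply: le_trans (ler_norm_sum _ _ _) _.
apply: le_trans (ler_sum (G := fun=> M) _ _) _; last by rewrite sumr_const.
by move=> z _; rewrite normrM norm_conjC g1 mulr1.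
Qed.

Lemma fourier_truncation f (B : {set Z}) (M eps delta : C) :
    (forall z, `|f z| <= M) -> 0 < delta -> B != finset.set0 ->
    (forall b b', b \in B -> b' \in B ->
      forall z, `|f (z + b) - f (z + b')| <= eps) ->
  exists (S : seq {ffun Z -> C}) (lambda : {ffun Z -> C} -> C),
    [/\ uniq S,
        forall gamma, gamma \in S -> unitary_char gamma,
        (size S)%:R <= M ^+ 2 / delta ^+ 2,
        forall gamma, gamma \in S -> `|lambda gamma| <= M &
        forall z, `|f z - \sum_(gamma <- S) lambda gamma * gamma z|
                    <= eps + delta * (#|Z|%:R / #|B|%:R)].
Proof.
move=> fM delta0 B0 feps.
have [D [Du Dc DE]] := fourier_inversion.
have nZ0 : (0 : C) < #|Z|%:R by rewrite lt_def card_zmod_neq0 ler0n.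
have nB0 : (0 : C) < #|B|%:R by rewrite ltr0n card_gt0.
have M0 : 0 <= M by apply: le_trans (fM 0).
(* [beta] is, up to conjugation, the Fourier transform of the uniform measure on [B]; [lambda] gives
   the coefficients of [f] averaged over [B - B]. *)
pose beta (gamma : {ffun Z -> C}) : C := #|B|%:R^-1 * \sum_(b in B) gamma b.
pose lambda gamma := fourier f gamma * `|beta gamma| ^+ 2.
have beta1 gamma : gamma \in D -> `|beta gamma| <= 1.
  move=> gD; rewrite normrM normfV normr_nat ler_pdivrMl // mulr1.
  apply: le_trans (ler_norm_sum _ _ _) _.
  by rewrite -sumr_const; apply: ler_sum => b _; rewrite (Dc _ gD).2.
have betaE gamma : gamma \in D -> `|beta gamma| ^+ 2 =
    #|B|%:R^-1 ^+ 2 * \sum_(b in B) \sum_(b' in B) gamma (b - b').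
  move=> gD; have [gM g1] := Dc _ gD.
  rewrite normCK rmorphM /= fmorphV rmorph_nat rmorph_sum /=.
  rewrite mulrACA -expr2 big_distrlr /=; congr (_ * _).
  apply: eq_bigr => b _; apply: eq_bigr => b' _.
  by have := gM (b - b') b'; rewrite subrK => ->; rewrite -mulrA -normCK g1 expr1n mulr1.
(* Parseval for the indicator function of [B]. *)
have beta2 : \sum_(gamma <- D) `|beta gamma| ^+ 2 = #|Z|%:R / #|B|%:R.
  have fB (gamma : {ffun Z -> C}) :
      `|fourier (fun z => (z \in B)%:R) gamma| = #|B|%:R / #|Z|%:R * `|beta gamma|.
    rewrite /fourier /beta !normrM !normfV !normr_nat.
    rewrite [X in _ = X]mulrA (mulrAC #|B|%:R) mulfV ?gt_eqF // mul1r.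
    rewrite -[in RHS]norm_conjC rmorph_sum /=.
    rewrite [in RHS]big_mkcond /=; congr (_ * `|_|); apply: eq_bigr => z _.
    by case: ifP; rewrite ?mul1r ?mul0r.
  have := fourier_parseval (DE (fun z => (z \in B)%:R)).
  under eq_bigr do rewrite fB exprMn.
  rewrite -big_distrr /=.
  have -> : \sum_z `|(z \in B)%:R : C| ^+ 2 = #|B|%:R.
    rewrite -sum1_card natr_sum [RHS]big_mkcond /=; apply: eq_bigr => z _.
    by rewrite normr_nat; case: (z \in B); rewrite ?expr1n ?expr0n.
  move=> e; apply: (@mulfI _ ((#|B|%:R / #|Z|%:R) ^+ 2)).
    by rewrite expf_neq0 // mulf_neq0 ?invr_eq0 ?gt_eqF.
  by rewrite e; field; rewrite !gt_eqF.
(* Frequencies are selected by the coefficients of [f] itself, so that Parseval for [f] bounds their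
   number. *)
pose S := [seq gamma <- D | delta <= `|fourier f gamma|].
exists S, lambda; split.
- exact: filter_uniq.
- by move=> gamma; rewrite mem_filter => /andP[_ /Dc].
- rewrite ler_pdivlMr ?exprn_gt0 //.
  apply: (@le_trans _ _ (\sum_(gamma <- D) `|fourier f gamma| ^+ 2)).
    rewrite (bigID (fun gamma => delta <= `|fourier f gamma|)) /= -[leLHS]addr0.
    apply: lerD; last by apply: sumr_ge0 => *; rewrite exprn_ge0.
    apply: (@le_trans _ _ (\sum_(gamma <- D | delta <= `|fourier f gamma|) delta ^+ 2)).
      by rewrite big_const_seq iter_addr_0 size_filter mulr_natl.
    by apply: ler_sum => gamma dg; rewrite lerXn2r ?nnegrE // ltW.
  rewrite (fourier_parseval (DE f)) ler_pdivrMl // mulr_natl.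
  apply: le_trans (ler_sum (G := fun=> M ^+ 2) _ _) _; last by rewrite sumr_const.
  by move=> z _; rewrite lerXn2r ?nnegrE.
- move=> gamma; rewrite mem_filter => /andP[_ gD].
  rewrite normrM normrX normr_id -[M]mulr1; apply: ler_pM; rewrite ?exprn_ge0 //.
    by apply: fourier_bound => //; apply: Dc.
  by rewrite exprn_ile1 ?beta1.
move=> z.
pose g := #|B|%:R^-1 ^+ 2 * \sum_(b in B) \sum_(b' in B) f (z + (b - b')).
have gE : g = \sum_(gamma <- D) lambda gamma * gamma z.
  rewrite [RHS]big_seq (eq_bigr (fun gamma => #|B|%:R^-1 ^+ 2 *
    (\sum_(b in B) \sum_(b' in B) fourier f gamma * gamma (z + (b - b'))))).
    rewrite -big_seq -big_distrr exchange_big /=; congr (_ * _).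
    apply: eq_bigr => b _; rewrite exchange_big /=.
    by apply: eq_bigr => b' _; apply: DE.
  move=> gamma gD; rewrite /lambda betaE //.
  have -> : \sum_(b in B) \sum_(b' in B) fourier f gamma * gamma (z + (b - b'))
      = fourier f gamma * gamma z * \sum_(b in B) \sum_(b' in B) gamma (b - b').
    rewrite big_distrr /=; apply: eq_bigr => b _; rewrite big_distrr /=.
    by apply: eq_bigr => b' _; rewrite (Dc _ gD).1 mulrA.
  by ring.
(* Writing [f z] as [f ((z - b') + b')] makes each term a difference of two translates of [f] by
   elements of [B]. *)
have fg : `|f z - g| <= eps.
  have -> : f z - g = #|B|%:R^-1 ^+ 2 *
      \sum_(b in B) \sum_(b' in B) (f (z - b' + b') - f (z - b' + b)).
    rewrite (eq_bigr (fun b => #|B|%:R * f z - \sum_(b' in B) f (z + (b - b')))).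
      by rewrite sumrB sumr_const -mulr_natl /g; field; rewrite gt_eqF.
    move=> b _; rewrite sumrB (eq_bigr (fun=> f z)) ?sumr_const ?mulr_natl.
      by congr (_ - _); apply: eq_bigr => b' _; rewrite -addrA (addrC (- b')).
    by move=> b' _; rewrite subrK.
  rewrite normrM normrX normfV normr_nat exprVn ler_pdivrMl ?exprn_gt0 //.
  apply: le_trans (ler_norm_sum _ _ _) _.
  apply: le_trans (ler_sum (G := fun=> #|B|%:R * eps) _ _) _.
    move=> b bB; apply: le_trans (ler_norm_sum _ _ _) _.
    apply: le_trans (ler_sum (G := fun=> eps) _ _) _.
      by move=> b' b'B; apply: feps.
    by rewrite sumr_const mulr_natl.
  by rewrite sumr_const -[_ *+ _]mulr_natl mulrA -expr2.
rewrite -[f z](subrK g) -addrA; apply: le_trans (ler_normD _ _) _.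
apply: lerD => //.
rewrite gE (bigID (fun gamma => delta <= `|fourier f gamma|)) /= -big_filter -/S.
rewrite addrC addKr -beta2 big_distrr /=.
apply: le_trans (ler_norm_sum _ _ _) _.
rewrite [leRHS](bigID (fun gamma => delta <= `|fourier f gamma|)) /= -[leLHS]add0r.
apply: lerD.
  by apply: sumr_ge0 => gamma _; rewrite mulr_ge0 ?exprn_ge0 // ltW.
rewrite big_seq_cond [leRHS]big_seq_cond; apply: ler_sum => gamma /andP[gD].
rewrite -real_ltNge ?ger0_real ?(ltW delta0) // => lt_d.
rewrite normrM (Dc _ gD).2 mulr1 normrM [X in _ * X]ger0_norm ?exprn_ge0 //.
by apply: ler_wpM2r; rewrite ?exprn_ge0 // ltW.
Qed.

End Fourier.

(** * Cubes of an abelian group *)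

(** Vertices are written as lists of coordinates; those beyond the end of the list are [false]. *)
Definition vertex n (s : seq bool) : cube n := [ffun i : 'I_n => nth false s i].

Lemma sum_cube2 (A : zmodType) (f : cube 2 -> A) :
  \sum_v f v = \sum_a \sum_b f (vertex 2 [:: a; b]).
Proof.
rewrite pair_big /= (reindex (fun p => vertex 2 [:: p.1; p.2])) //=.
exists (fun v : cube 2 => (v 0, v 1)) => [[a b] _|v _]; first by rewrite !ffunE.
apply/ffunP => i; rewrite ffunE.
by case: i => -[|[|//]] ? /=; congr (v _); apply: val_inj.
Qed.

Lemma sum_cube3 (A : zmodType) (f : cube 3 -> A) :
  \sum_v f v = \sum_a \sum_b \sum_c f (vertex 3 [:: a; b; c]).
Proof.
rewrite pair_big /= pair_big /=.
rewrite (reindex (fun p => vertex 3 [:: p.1.1; p.1.2; p.2])) //=.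
exists (fun v : cube 3 => (v 0, v 1, v 2)) => [[[a b] c] _|v _].
  by rewrite !ffunE.
apply/ffunP => i; rewrite ffunE.
by case: i => -[|[|[|//]]] ? /=; congr (v _); apply: val_inj.
Qed.

(** The cube morphisms without reflections: each target coordinate copies a source coordinate or is
    constant. They suffice to reach faces. *)
Definition cube_subst m n (s : 'I_n -> 'I_m + bool) (v : cube m) : cube n :=
  [ffun i => match s i with inl j => v j | inr b => b end].

Lemma cube_subst_morphism m n (s : 'I_n -> 'I_m + bool) :
  cube_morphism (cube_subst s).
Proof.
exists (fun i j => if s i is inl k then (j == k)%:Z else 0),
  (fun i => if s i is inr b then (b : nat)%:Z else 0) => v i.
rewrite ffunE; case: (s i) => [k|b]; last by rewrite big1 ?addr0 // => j _; rewrite mul0r.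
rewrite add0r (bigD1 k) //= eqxx mul1r big1 ?addr0 // => j /negPf->.
by rewrite mul0r.
Qed.

Lemma forall_set1 (T : finType) (i : T) (Q : pred T) :
  [forall (j | j \in [set i]%SET), Q j] = Q i.
Proof.
apply/forall_inP/idP => [|Qi j]; first by apply; rewrite inE.
by rewrite inE => /eqP->.
Qed.

Lemma forall_set2 (T : finType) (i k : T) (Q : pred T) :
  [forall (j | j \in [set i; k]%SET), Q j] = Q i && Q k.
Proof.
apply/forall_inP/andP => [H|[Qi Qk] j]; first by split; apply: H; rewrite !inE eqxx ?orbT.
by rewrite !inE => /orP[] /eqP->.
Qed.

Section Dcubes.
Variable A : zmodType.
Implicit Types (j n : nat).

Lemma Dcubes1_face n (c : cube n -> A) (s : 'I_n -> 'I_2 + bool) :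
  Dcubes 1 c ->
  let c' a b := c (cube_subst s (vertex 2 [:: a; b])) in
  c' true true - c' false true = c' true false - c' false false.
Proof.
move=> /(_ _ (cube_subst_morphism s)); rewrite sum_cube2 !big_bool /=.
rewrite /cube_weight !big_ord_recl !big_ord0 !ffunE /=.
rewrite !expr0 !expr1 expr2 !mulrN1z !mulr1z => e.
apply/eqP; rewrite -subr_eq0 opprB (addrC (c _)) addrACA.
by rewrite addrC; apply/eqP.
Qed.

(** The vanishing alternating sum over the whole 3-cube, arranged to say that the second difference
    in the outer two directions is the same on both faces of the middle direction. *)
Lemma Dcubes2_alternate (c : cube 3 -> A) : Dcubes 2 c ->
  let c' x y z := c (vertex 3 [:: x; y; z]) in
  (c' true true true - c' false true true)
    - (c' true true false - c' false true false)
  = (c' true false true - c' false false true)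
    - (c' true false false - c' false false false).
Proof.
have idE (v : cube 3) : cube_subst inl v = v by apply/ffunP => i; rewrite ffunE.
move=> Hc c'; rewrite {}/c'; move: Hc => /(_ _ (cube_subst_morphism inl)).
under eq_bigr do rewrite idE.
rewrite sum_cube3 !big_bool /=.
rewrite /cube_weight !big_ord_recl !big_ord0 !ffunE /=.
rewrite !expr0 !expr1 !exprS !expr0 !mulr1 !mulrN1 !opprK !mulrN1z !mulr1z => e.
move: e; set x1 := c _; set x2 := c _; set x3 := c _; set x4 := c _.
set x5 := c _; set x6 := c _; set x7 := c _; set x8 := c _.
rewrite !addrA => e; apply/esym/eqP; rewrite -subr_eq0; apply/eqP/(etrans _ e).
by rewrite !opprD !opprK !addrA (ACl (5*7*1*3*6*8*2*4)).
Qed.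

Lemma DcubesD j n (c c' : cube n -> A) :
  Dcubes j c -> Dcubes j c' -> Dcubes j (fun v => c v + c' v).
Proof.
move=> Hc Hc' psi psiP; under eq_bigr do rewrite mulrzDl.
by rewrite big_split /= Hc // Hc' // addr0.
Qed.

(* A cube morphism has coordinates depending on at most one variable each, so
   among j+1 variables one is irrelevant to the j coordinates in J; flipping it
   cancels the alternating sum. *)
Lemma Dcubes_face j n (J : {set 'I_n}) (b : cube n) (r : A) : (#|J| <= j)%N ->
  Dcubes j (fun v => if [forall (i | i \in J), v i == b i] then r else 0).
Proof.
move=> Jj psi [M [d psiE]].
(* With two non-zero coefficients, coordinate [i] could not stay in {0,1} at the four vertices
   supported on [k] and [k']. *)
have M1 i k k' : M i k != 0 -> M i k' != 0 -> k = k'.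
  move=> Mk Mk'; apply/eqP/negPn/negP => kk'.
  have val (v : cube j.+1) : ((psi v i : nat)%:Z == 0) || ((psi v i : nat)%:Z == 1).
    by case: (psi v i).
  have one l : \sum_(k < j.+1) M i k * ([ffun k => k == l] k : nat)%:Z = M i l.
    rewrite (bigD1 l) //= ffunE eqxx mulr1 big1 ?addr0 // => m /negPf ml.
    by rewrite ffunE ml mulr0.
  have two : \sum_(l < j.+1) M i l * ([ffun l => (l == k) || (l == k')] l : nat)%:Z
      = M i k + M i k'.
    rewrite (bigD1 k) //= (bigD1 k') //=; last by rewrite eq_sym.
    rewrite !ffunE !eqxx orbT !mulr1 big1 ?addr0 // => m /andP[/negPf mk /negPf mk'].
    by rewrite ffunE mk mk' mulr0.
  have zero : \sum_(l < j.+1) M i l * (([ffun=> false] : cube _) l : nat)%:Z = 0.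
    by rewrite big1 // => l _; rewrite ffunE mulr0.
  move: (val [ffun=> false]) (val [ffun l => l == k]) (val [ffun l => l == k'])
    (val [ffun l => (l == k) || (l == k')]).
  rewrite !psiE !one two zero; lia.
pose used := [set k | [exists i in J, M i k != 0]]%SET.
have /existsP[k0 k0P] : [exists k, k \notin used].
  apply: contraT; rewrite negb_exists => /forallP all_used.
  pose f i := odflt ord0 [pick k | M i k != 0].
  suff : (j.+1 <= #|f @: J|)%N by rewrite leqNgt ltnS (leq_trans (leq_imset_card _ _)).
  rewrite -{1}(card_ord j.+1) subset_leq_card //; apply/fintype.subsetP => k _.
  have := all_used k; rewrite negbK inE => /existsP[i /andP[iJ Mik]].
  apply/imsetP; exists i => //; rewrite /f; case: pickP => [k' Mik'|/(_ k)].
    exact: M1 Mik Mik'.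
  by rewrite Mik.
pose fl (v : cube j.+1) : cube j.+1 := [ffun k => (k == k0) (+) v k].
have flK : involutive fl.
  by move=> v; apply/ffunP => k; rewrite !ffunE addbA addbb.
have flJ v i : i \in J -> psi (fl v) i = psi v i.
  move=> iJ; have := psiE (fl v) i.
  rewrite (eq_bigr (fun k => M i k * (v k : nat)%:Z)) -?psiE.
    by case: (psi _ _) (psi _ _) => -[].
  move=> k _; rewrite ffunE; case: eqP => [->|//].
  move: k0P; rewrite inE negb_exists => /forallP/(_ i).
  by rewrite iJ negbK => /eqP->; rewrite !mul0r.
have flw v : ((-1) ^+ cube_weight (fl v) = - (-1) ^+ cube_weight v :> int).
  rewrite /cube_weight (bigD1 k0) //= [in RHS](bigD1 k0) //= !ffunE eqxx !exprD.
  rewrite (eq_bigr (fun k => v k : nat)) => [|k /negPf kk0]; last by rewrite ffunE kk0.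
  by rewrite -mulNr; congr (_ * _); case: (v k0).
rewrite (bigID (fun v : cube j.+1 => v k0)) /=.
rewrite [X in _ + X](reindex_inj (can_inj flK)) /=.
rewrite [X in _ + X](eq_bigl (fun v : cube j.+1 => v k0)); last first.
  by move=> v; rewrite ffunE eqxx addTb negbK.
rewrite -big_split /= big1 // => v _.
have -> : [forall (i | i \in J), psi (fl v) i == b i] =
    [forall (i | i \in J), psi v i == b i].
  by apply/eq_forallb => i; case: (boolP (i \in J)) => //= iJ; rewrite flJ.
by rewrite flw mulrNz subrr.
Qed.

Lemma eq_Dcubes j n (c c' : cube n -> A) : c =1 c' -> Dcubes j c -> Dcubes j c'.
Proof. by move=> e Hc psi psiP; under eq_bigr do rewrite -e; apply: Hc. Qed.

Lemma Dcubes_cst j n (r : A) : Dcubes j (fun _ : cube n => r).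
Proof.
have := @Dcubes_face j n finset.set0 [ffun=> true] r; rewrite cards0 => /(_ (leq0n j)).
by apply: eq_Dcubes => v; case: forallP => // -[] i; rewrite inE.
Qed.

Lemma Dcubes_coord j n (i : 'I_n) (r : A) : (0 < j)%N ->
  Dcubes j (fun v => if v i then r else 0).
Proof.
move=> j0; have := @Dcubes_face j n [set i]%SET [ffun=> true] r; rewrite cards1 => /(_ j0).
by apply: eq_Dcubes => v; rewrite forall_set1 ffunE eqb_id.
Qed.

(** Chaining the parallelogram relations of 2-faces makes all parallel edges equal. Directions 0 and
    2 are the ones compared when lifting. *)
Lemma Dcubes1_parallel (c : cube 3 -> A) : Dcubes 1 c ->
  let c' x y z := c (vertex 3 [:: x; y; z]) in
  (forall y z, c' true y z - c' false y z = c' true false false - c' false false false) /\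
  (forall x y, c' x y true - c' x y false = c' false false true - c' false false false).
Proof.
move=> Hc c'.
have face s := Dcubes1_face s Hc.
pose pick_coord (f : 'I_2 + bool) (g : 'I_2 + bool) (h : 'I_2 + bool) (i : 'I_3) :=
  nth (inr false) [:: f; g; h] i.
have pickE f g h a b : cube_subst (pick_coord f g h) (vertex 2 [:: a; b]) =
    vertex 3 [seq if k is inl j then nth false [:: a; b] (j : 'I_2)
                  else if k is inr x then x else false | k <- [:: f; g; h]].
  apply/ffunP => -[[|[|[|//]]] ?]; rewrite !ffunE /pick_coord /=;
    by case: (f) (g) (h) => ? [] ? [] ? //=; rewrite ffunE.
have e1 z := face (pick_coord (inl 0) (inl 1) (inr z)).
have e2 := face (pick_coord (inl 0) (inr false) (inl 1)).
have e3 y := face (pick_coord (inl 1) (inr y) (inl 0)).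
have e4 := face (pick_coord (inr false) (inl 1) (inl 0)).
rewrite /= !pickE /= in e2 e4.
split.
  have H1 z : c' true true z - c' false true z = c' true false z - c' false false z.
    by have := e1 z; rewrite /= !pickE.
  by case=> -[]; rewrite ?H1.
have H3 x y : c' x y true - c' x y false = c' false y true - c' false y false.
  by case: x => //; have := e3 y; rewrite /= !pickE.
by move=> x y; rewrite H3; case: y.
Qed.

End Dcubes.

(** * Lifting cubes to a free nilspace *)

Section FreeCubes.
Variables (R : realType) (a1 b1 a2 b2 : nat).
Local Notation F := (free2 R a1 b1 a2 b2).
Local Notation C := (free_cubes R a1 b1 a2 b2).

(** Such a map is a constant plus a multiple of one coordinate, in both components; thus any two
    points of the free nilspace span a cube. *)
Lemma free_cubes_edge (n : nat) (i : 'I_n) (w : bool -> F) : C n (fun v => w (v i)).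
Proof.
split.
  apply: (@eq_Dcubes _ _ _ (fun v => (w false).1 +
      (if v i then (w true).1 - (w false).1 else 0))) => [v|].
    by rewrite /=; case: (v i); rewrite ?addr0 // addrC subrK.
  by apply: DcubesD; [exact: Dcubes_cst | exact: Dcubes_coord].
apply: (@eq_Dcubes _ _ _ (fun v => (w false).2 +
    (if v i then (w true).2 - (w false).2 else 0))) => [v|].
  by rewrite /=; case: (v i); rewrite ?addr0 // addrC subrK.
by apply: DcubesD; [exact: Dcubes_cst | exact: Dcubes_coord].
Qed.

Lemma free_cubes_add_face n (c : cube n -> F) (J : {set 'I_n}) (b : cube n)
    (r : free_group R a2 b2) : C n c -> (#|J| <= 2)%N ->
  C n (fun v => ((c v).1,
               (c v).2 + if [forall (i | i \in J), v i == b i] then r else 0)).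
Proof.
by move=> [c1 c2] J2; split => //; apply: DcubesD c2 _; apply: Dcubes_face.
Qed.

Let o : F := (0 : free_group R a1 b1, 0 : free_group R a2 b2).

(** Apply [h] on a face transverse to an edge from the origin to [p]: the first components form a
    [Dcubes 1] cube, whose parallel edges compare the displacement at [p] with that at the
    origin. *)
Lemma translation1_shift h : translation C 1 h ->
  exists s, forall p, (h p).1 = p.1 + s.
Proof.
move=> hT; exists (h o).1 => p.
have := hT 3 _ [set 0]%SET [ffun=> true]
  (free_cubes_edge (2 : 'I_3) (fun b => if b then p else o)).
rewrite cards1 => /(_ erefl)[/Dcubes1_parallel[/(_ false true) + _] _].
rewrite /= !forall_set1 !ffunE /= subr0 => <-.
by rewrite addrC subrK.
Qed.

End FreeCubes.

(** * Moving the vertices of a lifted cube within orbits of the lattice action *)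

Section Lifting.
Variables (R : realType) (X : cfr_nilspace2 R) (P : free_presentation X).
Local Notation F := (free2 R (fp_a1 P) (fp_b1 P) (fp_a2 P) (fp_b2 P)).
Local Notation C := (free_cubes R (fp_a1 P) (fp_b1 P) (fp_a2 P) (fp_b2 P)).
Local Notation pr := (@fp_proj R X P).
Let la := fp_action P.

Lemma proj_orbit h p : fp_H h -> pr (h p) = pr p.
Proof. by move=> Hh; apply/esym/fp_orbit; exists h. Qed.

Lemma proj_cube n (c : cube n -> F) : C n c -> cfr_cubes X n (pr \o c).
Proof. by move=> Cc; rewrite (fp_cubes P); exists c. Qed.

(** Elements of the group are translations of height 1: the one taking [c u] to [w] may be applied
    on a face through [u] only, leaving the opposite face untouched. *)
Lemma lift_face n (c : cube n -> F) (u : cube n) (i : 'I_n) (w : F) :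
    C n c -> pr w = pr (c u) ->
  exists c', [/\ C n c', forall v, pr (c' v) = pr (c v), c' u = w &
                 forall v : cube n, v i != u i -> c' v = c v].
Proof.
move=> Cc /esym/fp_orbit[h Hh wE].
exists (fun v : cube n => if [forall (j | j \in [set i]%SET), v j == u j] then h (c v) else c v).
split.
- by apply: la_translation Hh _ _ _ _ Cc _ => //; rewrite cards1.
- by move=> v; case: ifP => // _; rewrite proj_orbit.
- by rewrite forall_set1 eqxx wE.
- by move=> v; rewrite forall_set1 => /negPf->.
Qed.

(** When the first coordinate is already right, fibre-transitivity replaces the group element by one
    of height 2, which moves only a face of codimension 2. *)
Lemma lift_face2 n (c : cube n -> F) (u : cube n) (i k : 'I_n) (w : F) :
    i != k -> C n c -> pr w = pr (c u) -> w.1 = (c u).1 ->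
  exists c', [/\ C n c', forall v, pr (c' v) = pr (c v), c' u = w &
                 forall v : cube n, ~~ ((v i == u i) && (v k == u k)) -> c' v = c v].
Proof.
move=> ik Cc /esym/fp_orbit[h0 Hh0 ->] w1.
have [h [Hh hT <-]] := la_fibre_transitive la Hh0 w1.
exists (fun v : cube n => if [forall (j | j \in [set i; k]%SET), v j == u j] then h (c v) else c v).
split.
- by apply: hT Cc _; rewrite cards2 ik.
- by move=> v; case: ifP => // _; rewrite proj_orbit.
- by rewrite forall_set2 !eqxx.
- by move=> v; rewrite forall_set2 => /negPf->.
Qed.

Lemma fundamental_domain1 : exists2 K : set (free_group R (fp_a1 P) (fp_b1 P)),
  compact K & forall p, exists2 p', pr p' = pr p & K p'.1.
Proof.
have [_ _ _ [K Kc KP]] := la_lattice1 la; exists K => // p.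
have [s [k [[h Hh hs] Kk e]]] := KP p.1.
have [g Hg [hK gK]] := la_inv la Hh.
exists (g p); first exact: proj_orbit.
by have := hs (g p); rewrite gK e addrC => /addIr <-.
Qed.

(** The vertical lattice acts by adding constants, so [t] depends on [b] alone and preserves the
    image of every point at once. *)
Lemma fundamental_domain2 : exists2 K : set (free_group R (fp_a2 P) (fp_b2 P)),
  compact K & forall b, exists2 t, K (b + t) & forall p : F, pr (p.1, p.2 + t) = pr p.
Proof.
have [G0 GB _ [K Kc KP]] := la_lattice2 la; exists K => // b.
have [t [k [Gt Kk e]]] := KP b; exists (- t); first by rewrite e (addrC t) addrK.
have [h Hh ht] := GB _ _ G0 Gt; rewrite sub0r in ht.
by move=> p; rewrite -ht proj_orbit.
Qed.

(** Points of one orbit have first coordinates differing by an element of the first lattice, and 0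
    is its only element in [U]. *)
Lemma lattice1_discrete : exists2 U : set (free_group R (fp_a1 P) (fp_b1 P)),
  nbhs 0 U & forall p q, pr p = pr q -> U (p.1 - q.1) -> p.1 = q.1.
Proof.
have [_ _ [U U0 UP] _] := la_lattice1 la; exists U => // p q.
move=> /esym/fp_orbit[h Hh ->].
have [s hs] := translation1_shift (la_translation la Hh).
rewrite hs addrC addKr => Us.
have -> : s = 0 by apply: UP; split => //; exists h.
by rewrite addr0.
Qed.

(* Adding r in the second coordinate on a face of codimension 2 of a 3-cube
   changes its image by a cube of D_2(Z_2) vanishing off an edge, hence constant
   on that edge. *)
Lemma vertical_shift (r : free_group R (fp_a2 P) (fp_b2 P)) (w : bool -> F) :
  exists z, forall e, pr ((w e).1, (w e).2 + r) = cfr_act2 (pr (w e)) z.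
Proof.
have G2 := cfr_group2 X.
(* In a 2-cube a face of codimension 2 is a single vertex, so [r] may be added at one vertex of a
   constant cube. *)
have proj1_shift (x : F) : cfr_proj1 (pr (x.1, x.2 + r)) = cfr_proj1 (pr x).
  apply/(factor_equiv (cfr_factor X)).
  have Cx : C 2 (fun=> x) by exact: (free_cubes_edge (0 : 'I_2) (fun=> x)).
  have Cx' := @free_cubes_add_face _ _ _ _ _ _ _ [set: 'I_2]%SET (cube0 2) r Cx.
  exists (pr \o (fun v => (x.1, x.2 +
    if [forall (i | i \in [set: 'I_2]%SET), v i == cube0 2 i] then r else 0))).
  exists (pr \o (fun=> x)); split.
  - by apply: proj_cube; apply: Cx'; rewrite cardsT card_ord.
  - exact: proj_cube.
  - by rewrite /=; case: forallP => // -[] i; rewrite eqxx implybT.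
  - by [].
  - move=> v v0 /=; case: forallP => [e|]; last by rewrite addr0 -surjective_pairing.
    case/eqP: v0; apply/ffunP => i; have := e i.
    by rewrite finset.in_setT => /eqP.
have Cw := free_cubes_edge (2 : 'I_3) w.
have Cw' := @free_cubes_add_face _ _ _ _ _ _ _ [set 0; 1]%SET [ffun=> true] r Cw.
rewrite cards2 in Cw'; have {}Cw' := Cw' erefl.
have [H _] := sg_cubes G2 (proj_cube Cw) (pr \o (fun v : cube 3 => ((w (v 2)).1,
  (w (v 2)).2 + if [forall (i | i \in [set 0; 1]%SET), v i == [ffun=> true] i]
                then r else 0))).
have [|d dD dE] := H.
  split; first exact: proj_cube Cw'.
  apply/funext => v /=; case: ifP => _; first exact: proj1_shift.
  by rewrite addr0 -surjective_pairing.
have {}dE a b e : pr ((w e).1, (w e).2 + if a && b then r else 0) =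
    cfr_act2 (pr (w e)) (d (vertex 3 [:: a; b; e])).
  have := congr1 (fun f => f (vertex 3 [:: a; b; e])) dE.
  by rewrite /= !ffunE forall_set2 !ffunE /= !eqb_id => <-.
have d0 a b e : ~~ (a && b) -> d (vertex 3 [:: a; b; e]) = 0.
  move=> /negPf ab; apply: (sg_free G2 (y := pr (w e))).
  by rewrite -dE ab addr0 -surjective_pairing.
have := Dcubes2_alternate dD; rewrite /= !(d0 false) // !(d0 true false) // !subr0 => /eqP.
rewrite subr_eq0 => /eqP d11.
exists (d (vertex 3 [:: true; true; true])) => e.
by rewrite (dE true true e); case: e; rewrite // d11.
Qed.

End Lifting.

(** * Lifting a parallelepiped through four prescribed lifts *)

Section Parallelepiped.
Variables (R : realType) (X : cfr_nilspace2 R) (P : free_presentation X).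
Local Notation F := (free2 R (fp_a1 P) (fp_b1 P) (fp_a2 P) (fp_b2 P)).
Local Notation C := (free_cubes R (fp_a1 P) (fp_b1 P) (fp_a2 P) (fp_b2 P)).
Local Notation pr := (@fp_proj R X P).

(** Directions 0, 1, 2 of the 3-cube are [y' - y], [z] and [h]. The lifts [p], [q], [p'], [q'] are
    imposed in turn, each by moving a face that avoids the vertices already fixed. *)
Lemma lift_parallelepiped (K U : set (free_group R (fp_a1 P) (fp_b1 P)))
    (Z : finZmodType) (phi : Z -> X) (h y y' z : Z) (p q p' q' : F) :
  (forall p, exists2 p', pr p' = pr p & K p'.1) ->
  (forall p q, pr p = pr q -> U (p.1 - q.1) -> p.1 = q.1) ->
  nil_morphism (Dcubes 1 (A := Z)) (cfr_cubes X) phi ->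
  pr p = phi y -> pr q = phi (y + h) -> pr p' = phi y' -> pr q' = phi (y' + h) ->
  U (q'.1 - (p'.1 - p.1 + q.1)) ->
  exists (w0 w1 : F) (r : free_group R (fp_a2 P) (fp_b2 P)),
    [/\ K w0.1 /\ w1.1 = q.1 - p.1 + w0.1,
        pr w0 = phi (y + z), pr w1 = phi (y + z + h),
        pr (p'.1 - p.1 + w0.1, r + w0.2) = phi (y' + z) &
        pr (p'.1 - p.1 + w1.1, (q'.2 - q.2) - (p'.2 - p.2) + r + w1.2)
          = phi (y' + z + h)].
Proof.
move=> KP UP phiP pE qE p'E q'E Uq.
have D1 : Dcubes 1 (fun v : cube 3 => y + (if v 0 then y' - y else 0) +
    (if v 1 then z else 0) + (if v 2 then h else 0)).
  by do !apply: DcubesD; rewrite ?Dcubes_coord //; [exact: Dcubes_cst|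
    exact: Dcubes_coord..].
have := phiP _ _ D1; rewrite (fp_cubes P) => -[c Cc cE].
pose V a b e := vertex 3 [:: a; b; e].
have {}cE a b e : pr (c (V a b e)) =
    phi ((if a then y' else y) + (if b then z else 0) + (if e then h else 0)).
  have := congr1 (fun f => f (V a b e)) cE; rewrite /= !ffunE /= => ->.
  by case: a; rewrite ?addr0 // (addrC y) subrK.
have [|c1 [C1 c1E c1p c1c]] := @lift_face _ _ _ _ c (V false false false) 0 p Cc.
  by rewrite cE !addr0.
have {}c1E a b e := etrans (c1E (V a b e)) (cE a b e).
have [|c2 [C2 c2E c2q c2c]] := @lift_face _ _ _ _ c1 (V false false true) 2 q C1.
  by rewrite c1E !addr0.
have {}c2E a b e := etrans (c2E (V a b e)) (c1E a b e).
have c2p : c2 (V false false false) = p by rewrite c2c ?c1p // !ffunE.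
have [|c3 [C3 c3E c3p' c3c]] := @lift_face _ _ _ _ c2 (V true false false) 0 p' C2.
  by rewrite c2E !addr0.
have {}c3E a b e := etrans (c3E (V a b e)) (c2E a b e).
have c3p : c3 (V false false false) = p by rewrite c3c ?c2p // !ffunE.
have c3q : c3 (V false false true) = q by rewrite c3c ?c2q // !ffunE.
(* The fourth vertex has first coordinate [p'.1 - p.1 + q.1] by parallelism; [q'] lies over the same
   point and is [U]-close, so discreteness gives equality. *)
have c3q' : q'.1 = (c3 (V true false true)).1.
  apply: UP; first by rewrite c3E addr0.
  have [/(_ false true) + _] := Dcubes1_parallel C3.1.
  rewrite /= -/(V _ _ _) -/(V _ _ _) -/(V _ _ _) -/(V _ _ _) c3q c3p c3p' => /eqP.
  by rewrite subr_eq => /eqP->.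
have [||c4 [C4 c4E c4q' c4c]] :=
  @lift_face2 _ _ _ _ c3 (V true false true) 0 2 q' _ C3 _ c3q'; first by [].
  by rewrite c3E addr0.
have {}c4E a b e := etrans (c4E (V a b e)) (c3E a b e).
have c4p : c4 (V false false false) = p by rewrite c4c ?c3p // !ffunE.
have c4q : c4 (V false false true) = q by rewrite c4c ?c3q // !ffunE.
have c4p' : c4 (V true false false) = p' by rewrite c4c ?c3p' // !ffunE.
(* The last move takes place on the face opposite to the four prescribed lifts and normalises the
   vertex above [y + z]. *)
have [w wE Kw] := KP (c4 (V false true false)).
have [c5 [C5 c5E c5w c5c]] := @lift_face _ _ _ _ c4 (V false true false) 1 w C4 wE.
have {}c5E a b e := etrans (c5E (V a b e)) (c4E a b e).
have c5p : c5 (V false false false) = p by rewrite c5c ?c4p // !ffunE.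
have c5q : c5 (V false false true) = q by rewrite c5c ?c4q // !ffunE.
have c5p' : c5 (V true false false) = p' by rewrite c5c ?c4p' // !ffunE.
have c5q' : c5 (V true false true) = q' by rewrite c5c ?c4q' // !ffunE.
have [par0 par2] := Dcubes1_parallel C5.1.
have alt := Dcubes2_alternate C5.2.
move: par0 par2 alt; rewrite /= -!/(V _ _ _) c5p c5q c5p' c5q' => par0 par2 alt.
have {}par0 y1 z1 : (c5 (V true y1 z1)).1 = p'.1 - p.1 + (c5 (V false y1 z1)).1.
  by rewrite -(par0 y1 z1) subrK.
have {}alt : (c5 (V true true true)).2 = (q'.2 - q.2) - (p'.2 - p.2) +
  ((c5 (V true true false)).2 - (c5 (V false true false)).2) + (c5 (V false true true)).2.
  by rewrite -alt !subrK.
exists (c5 (V false true false)), (c5 (V false true true)),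
  ((c5 (V true true false)).2 - (c5 (V false true false)).2); split.
- rewrite c5w; split => //.
  by rewrite -c5w -(par2 false true) subrK.
- by rewrite c5E addr0.
- by rewrite c5E.
- by rewrite subrK -par0 -surjective_pairing c5E addr0.
- by rewrite -par0 -alt -surjective_pairing c5E.
Qed.

End Parallelepiped.

(** * Distance along a chart *)

Lemma rV_norm_le (R : realType) n (u : 'rV[R]_n) (c : R) : 0 <= c ->
  (forall i, `|u 0 i| <= c) -> `|u| <= c.
Proof.
move=> c0 uc; rewrite [leLHS]/Num.Def.normr /= mx_normrE; apply/bigmax_leP; split=> // -[i j] _ /=.
by rewrite (ord1 i) uc.
Qed.

Lemma rV_coord_le (R : realType) n (u : 'rV[R]_n) i : `|u 0 i| <= `|u|.
Proof.
by rewrite [leRHS]/Num.Def.normr /= mx_normrE; apply/bigmax_geP; right => /=; exists (0, i).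
Qed.

Lemma lsubmx_continuous (R : realType) m n : continuous (@lsubmx R 1 m n).
Proof.
move=> M s /nbhs_ballP[e e0 es]; apply/nbhs_ballP; exists e => // N [_ MN].
by apply: es; split=> // i j; rewrite !mxE; apply: MN.
Qed.

Lemma rsubmx_continuous (R : realType) m n : continuous (@rsubmx R 1 m n).
Proof.
move=> M s /nbhs_ballP[e e0 es]; apply/nbhs_ballP; exists e => // N [_ MN].
by apply: es; split=> // i j; rewrite !mxE; apply: MN.
Qed.

Definition coord_bounded (R : realType) a b (N : nat) (x : free_group R a b) :=
  (forall i, `|x.1 0 i| <= N%:Z) /\ `|x.2| <= N%:R.

(** The integer part carries the discrete topology, so the sum of its absolute values is continuous,
    hence bounded on [K]. *)
Lemma compact_coord_bounded (R : realType) a b (K : set (free_group R a b)) :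
  compact K -> exists N, K `<=` coord_bounded N.
Proof.
move=> Kc.
pose f (x : free_group R a b) : R := (\sum_i `|x.1 0 i|)%:~R.
have fc : continuous f.
  move=> x.
  pose f1 (k : discrete_topology 'rV[int]_a) : R :=
     (\sum_i `|(k : 'rV[int]_a) 0 i|)%:~R.
  apply: (@continuous_comp _ _ _ fst f1); first exact: cvg_fst.
  move=> A /nbhs_singleton Ax.
  by apply: filterS (discrete_set1 _) => y ->.
have K1 : compact (f @` K) by apply: continuous_compact Kc; exact: continuous_subspaceT.
have K2 : compact ((fun x : free_group R a b => x.2) @` K).
  apply: continuous_compact Kc; apply: continuous_subspaceT => x; exact: cvg_snd.
have [M1 [_ H1]] := compact_bounded K1.
have [M2 [_ H2]] := compact_bounded K2.
pose N := (Num.truncn (Num.max (M1 + 1) (M2 + 1))).+1.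
have NM : Num.max (M1 + 1) (M2 + 1) < N%:R by exact: truncnS_gt.
rewrite gt_max in NM; case/andP: NM => NM1 NM2.
exists N => x Kx; split; last first.
  apply: (le_trans (H2 (M2 + 1) _ _ _)); rewrite ?ltrDl //; last exact: ltW.
  by exists x.
move=> i.
have : `|f x| <= N%:R.
  by apply: (le_trans (H1 (M1 + 1) _ _ _)); rewrite ?ltrDl //; last exact: ltW.
rewrite /f ger0_norm; last by rewrite ler0z sumr_ge0.
rewrite -[N%:R]/(N%:Z%:~R) ler_int; apply: le_trans.
by rewrite (bigD1 i) //= lerDl sumr_ge0.
Qed.

Lemma derivable_line (R : realType) n (u : 'rV[R]_n) (t : R) :
  derivable (fun t : R => t *: u) t 1 /\ derive1 (fun t : R => t *: u) t = u.
Proof.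
have d : differentiable (fun t : R => t *: u) t by exact/ex_diff.
split; first exact/derivable1_diffP.
by rewrite derive1E' // diff_val scale1r.
Qed.

Lemma quadratic_form_le (R : realType) n (M : 'M[R]_n) (u : 'rV[R]_n) (m : R) :
  (forall i j, `|M i j| <= m) -> (u *m M *m u^T) 0 0 <= m * (n%:R * `|u|) ^+ 2.
Proof.
move=> Mm; apply: le_trans (ler_norm _) _; rewrite mxE.
apply: le_trans (ler_norm_sum _ _ _) _.
apply: le_trans (ler_sum (G := fun=> n%:R * (`|u| * m) * `|u|) _ _) _; last first.
  rewrite sumr_const card_ord -mulr_natl le_eqVlt; apply/orP; left; apply/eqP; ring.
move=> j _; rewrite !mxE normrM; apply: ler_pM => //; last exact: rV_coord_le.
apply: le_trans (ler_norm_sum _ _ _) _.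
apply: le_trans (ler_sum (G := fun=> `|u| * m) _ _) _; last first.
  by rewrite sumr_const card_ord mulr_natl.
by move=> i _; rewrite normrM; apply: ler_pM => //; exact: rV_coord_le.
Qed.

Lemma continuous_sum (R : realType) (I : finType) (f : I -> R -> R) (x : R) :
  (forall i, {for x, continuous (f i)}) ->
  {for x, continuous (fun t => \sum_i f i t)}.
Proof.
move=> fc; elim: (index_enum I) => [|i s IHs].
  rewrite (_ : (fun _ => _) = cst 0); first exact: cst_continuous.
  by apply/funext => t; rewrite big_nil.
rewrite (_ : (fun _ => _) = f i \+ (fun t => \sum_(j <- s) f j t)).
  by apply: continuousD.
by apply/funext => t; rewrite big_cons.
Qed.

Section Metric.
Variables (R : realType) (X : cfr_nilspace2 R) (P : free_presentation X).
Variable g : riemannian_metric P.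
Local Notation F := (free2 R (fp_a1 P) (fp_b1 P) (fp_a2 P) (fp_b2 P)).
Local Notation n := (fp_b1 P + fp_b2 P)%N.
Local Notation V := 'rV[R]_n.
Local Notation pr := (@fp_proj R X P).

Lemma fp_proj_continuous : continuous pr.
Proof. by apply/continuousP => A /(fp_open P). Qed.

Lemma free_shift_continuous (p : F) : continuous (free_shift p).
Proof.
have pair_cts (T U W : topologicalType) (f1 : T -> U) (f2 : T -> W) :
    continuous f1 -> continuous f2 -> continuous (fun x => (f1 x, f2 x)).
  by move=> cf cg x; apply: cvg_pair; [exact: cf|exact: cg].
have cst_pair (T U W : topologicalType) (k : U) (f : T -> W) :
    continuous f -> continuous (fun x => (k, f x)).
  by move=> cf; apply: pair_cts => // x; apply: cvg_cst.
have addl_cts m (k : 'rV[R]_m) (f : V -> 'rV[R]_m) :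
    continuous f -> continuous (fun u => k + f u).
  by move=> cf u; exact: (cvgD (cvg_cst k) (cf u)).
have c1 : continuous (fun u : V => p.1.2 + lsubmx u).
  exact: (addl_cts _ p.1.2 _ (@lsubmx_continuous R _ _)).
have c2 : continuous (fun u : V => p.2.2 + rsubmx u).
  exact: (addl_cts _ p.2.2 _ (@rsubmx_continuous R _ _)).
exact: pair_cts (cst_pair _ (discrete_topology _) _ p.1.1 _ c1)
  (cst_pair _ (discrete_topology _) _ p.2.1 _ c2).
Qed.

Lemma free_shift0 (p : F) : free_shift p 0 = p.
Proof.
case: p => -[k1 x1] [k2 x2]; rewrite /free_shift /=; do 2?congr pair.
  by rewrite linear0 addr0.
by rewrite linear0 addr0.
Qed.

Lemma pw_curve_ge0 x y l : pw_curve g x y l -> 0 <= l.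
Proof.
elim=> // p gamma y' l' _ _ l0; rewrite addr_ge0 //.
by apply: Rintegral_ge0 => t _; rewrite sqrtr_ge0.
Qed.

Lemma rdist_ge0 x y : 0 <= rdist g x y.
Proof.
rewrite /rdist; case: ifP => // _.
have [->|/set0P H] := eqVneq [set l | pw_curve g x y l] set0; first by rewrite inf0.
by apply: lb_le_inf => // l; apply: pw_curve_ge0.
Qed.

(** The image of the curve is connected, so its endpoints lie in one component and [rdist] is an
    infimum over a set containing this length. *)
Lemma rdist_le_length (p : F) gamma : C1_curve gamma ->
  rdist g (pr (free_shift p (gamma 0))) (pr (free_shift p (gamma 1)))
    <= curve_length g p gamma.
Proof.
move=> gC1; rewrite /rdist ifT.
  apply: ge_inf.
    by exists 0 => l; apply: pw_curve_ge0.
  rewrite /= -[curve_length _ _ _]addr0.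
  by apply: pw_cons => //; apply: pw_nil.
have gc : continuous (pr \o (free_shift p \o gamma)).
  move=> t; apply: continuous_comp; last exact: fp_proj_continuous.
  apply: continuous_comp; last exact: free_shift_continuous.
  by apply: differentiable_continuous; apply/derivable1_diffP; apply: gC1.1.
apply/asboolP.
apply: (@connected_component_max _ _ ((pr \o (free_shift p \o gamma)) @` `[0, 1]%classic)).
- by exists 0 => //=; rewrite in_itv /= lexx ler01.
- by [].
- apply: connected_continuous_connected; last exact: continuous_subspaceT.
  exact: segment_connected.
- by exists 1 => //=; rewrite in_itv /= lexx ler01.
Qed.

Lemma tensor_continuous p i j : continuous (fun u : V => rm_tensor g (free_shift p u) i j).
Proof. by move=> u; have [H _] := rm_smooth g p i j 0; apply: H. Qed.

(** The straight segment in the chart has speed at most the right-hand side. *)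
Lemma rdist_line (p : F) (u : V) (m : R) : 0 <= m ->
  (forall t, 0 <= t <= 1 -> forall i j, `|rm_tensor g (free_shift p (t *: u)) i j| <= m) ->
  rdist g (pr p) (pr (free_shift p u)) <= Num.sqrt m * n%:R * `|u|.
Proof.
move=> m0 Tm.
have gC1 : C1_curve (fun t : R => t *: u).
  split=> [t|]; first by have [] := derivable_line u t.
  rewrite (_ : derive1 _ = cst u); last by apply/funext => t; have [] := derivable_line u t.
  exact: cst_continuous.
have := rdist_le_length p gC1; rewrite /= scale0r free_shift0 scale1r.
move/le_trans; apply; rewrite /curve_length.
pose c := Num.sqrt m * n%:R * `|u|.
under eq_Rintegral do rewrite (derivable_line u _).2.
have -> : Num.sqrt m * n%:R * `|u| = \int[lebesgue_measure]_(t in `[0, 1]%classic) c.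
  by rewrite Rintegral_cst //= lebesgue_measure_itv /= lte_fin ltr01 oppr0 adde0 mulr1.
apply: le_Rintegral => //.
- apply: continuous_compact_integrable; first exact: segment_compact.
  apply: continuous_subspaceT => t.
  apply: (@continuous_comp _ _ _ _ Num.sqrt); last exact: sqrt_continuous.
  rewrite (_ : (fun _ => _) = (fun x => \sum_j (\sum_i u 0 i *
     rm_tensor g (free_shift p (x *: u)) i j) * u 0 j)); last first.
    apply/funext => x; rewrite mxE; apply: eq_bigr => j _.
    by rewrite !mxE.
  apply: continuous_sum => j; apply: continuousM; last exact: cst_continuous.
  apply: continuous_sum => i; apply: continuousM; first exact: cst_continuous.
  apply: (@continuous_comp _ _ _ (fun t : R => t *: u)
    (fun v => rm_tensor g (free_shift p v) i j)); last exact: tensor_continuous.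
  by apply: differentiable_continuous; exact/ex_diff.
- apply: continuous_compact_integrable; first exact: segment_compact.
  by apply: continuous_subspaceT => t; apply: cst_continuous.
- move=> t; rewrite /= in_itv /= => t01.
  have := quadratic_form_le u (Tm _ t01); rewrite -ler_sqrt; last first.
    by rewrite mulr_ge0 ?exprn_ge0 ?mulr_ge0.
  by rewrite sqrtrM // sqrtr_sqr ger0_norm ?mulr_ge0 // /c mulrA.
Qed.

End Metric.

(** * Compact sets of the free nilspace *)

Definition int_box a N (f : {ffun 'I_a -> 'I_(2 * N).+1}) : 'rV[int]_a :=
  \row_i ((f i)%:Z - N%:Z).

Lemma int_box_surj a N (k : 'rV[int]_a) : (forall i, `|k 0 i| <= N%:Z) ->
  exists f, k = @int_box a N f.
Proof.
move=> kN; exists [ffun i => inord (absz (k 0 i + N%:Z))].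
apply/rowP => i; rewrite mxE ffunE inordK; have := kN i; lia.
Qed.

Lemma row_mx_norm_le (R : realType) m n (x : 'rV[R]_m) (y : 'rV[R]_n) (c : R) :
  `|x| <= c -> `|y| <= c -> `|row_mx x y| <= c.
Proof.
move=> xc yc; apply: rV_norm_le; first exact: le_trans (normr_ge0 _) xc.
move=> i; rewrite mxE; case: fintype.split => j.
  exact: le_trans (rV_coord_le _ _) xc.
exact: le_trans (rV_coord_le _ _) yc.
Qed.

Lemma lsubmx_norm_le (R : realType) m n (u : 'rV[R]_(m + n)) : `|lsubmx u| <= `|u|.
Proof. by apply: rV_norm_le => // i; rewrite mxE rV_coord_le. Qed.

Lemma rsubmx_norm_le (R : realType) m n (u : 'rV[R]_(m + n)) : `|rsubmx u| <= `|u|.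
Proof. by apply: rV_norm_le => // i; rewrite mxE rV_coord_le. Qed.

Lemma coord_bounded_addreal (R : realType) a b N N' (x : free_group R a b) (v : 'rV[R]_b) :
  coord_bounded N x -> `|v| <= N'%:R -> coord_bounded (N + N') ((x.1, x.2 + v) : free_group R a b).
Proof.
move=> [x1 x2] vN; split=> [i|] /=.
  by rewrite PoszD; apply: le_trans (x1 i) _; rewrite lerDl.
by rewrite natrD; apply: le_trans (ler_normD _ _) _; rewrite lerD.
Qed.

Lemma coord_boundedD (R : realType) a b N N' (x y : free_group R a b) :
  coord_bounded N x -> coord_bounded N' y -> coord_bounded (N + N') (x + y).
Proof.
move=> [x1 x2] [y1 y2]; split=> [i|].
  by rewrite mxE PoszD; apply: le_trans (ler_normD _ _) _; rewrite lerD.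
by rewrite natrD; apply: le_trans (ler_normD _ _) _; rewrite lerD.
Qed.

Lemma coord_boundedN (R : realType) a b N (x : free_group R a b) :
  coord_bounded N x -> coord_bounded N (- x).
Proof.
by move=> [x1 x2]; split=> [i|]; rewrite ?normrN //= mxE normrN.
Qed.

Lemma coord_boundedW (R : realType) a b N N' (x : free_group R a b) : (N <= N')%N ->
  coord_bounded N x -> coord_bounded N' x.
Proof.
move=> NN [x1 x2]; split=> [i|]; first by apply: le_trans (x1 i) _; rewrite lez_nat.
by apply: le_trans x2 _; rewrite ler_nat.
Qed.

(** Integer coordinates are recorded exactly and real ones by their cell of width [eta]. Each real
    coordinate meets at most [2N/eta + 1 <= (2N+1)/eta] cells, because [eta <= 1]. *)
Lemma grid_coloring (R : realType) a b N (eta : R) : 0 < eta <= 1 ->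
  exists (T : finType) (col : free_group R a b -> T),
    #|T|%:R <= ((2 * N).+1%:R : R) ^+ (a + b) * eta ^- b /\
    forall x y, coord_bounded N x -> coord_bounded N y -> col x = col y ->
      x.1 = y.1 /\ `|x.2 - y.2| <= eta.
Proof.
move=> /andP[eta0 eta1].
pose M := Num.truncn ((2 * N)%:R / eta).
exists ({ffun 'I_a -> 'I_(2 * N).+1} * {ffun 'I_b -> 'I_M.+1})%type.
exists (fun x : free_group R a b => ([ffun i => inord (absz (x.1 0 i + N%:Z))],
  [ffun i => inord (Num.truncn ((x.2 0 i + N%:R) / eta))])); split.
  rewrite card_prod !card_ffun !card_ord natrM !natrX exprD -mulrA.
  rewrite ler_wpM2l ?exprn_ge0 // -exprVn -exprMn lerXn2r ?nnegrE //.
    by rewrite mulr_ge0 // invr_ge0 ltW.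
  rewrite -natr1 -[in leRHS]natr1 mulrDl mul1r; apply: lerD.
    by rewrite truncn_le // divr_ge0 // ltW.
  by rewrite invf_ge1.
move=> x y [x1 x2] [y1 y2] [/ffunP e1 /ffunP e2]; split.
  apply/rowP => i; have := e1 i; rewrite !ffunE => /(congr1 val).
  by rewrite /= !inordK; have := x1 i; have := y1 i; lia.
apply: rV_norm_le => [|i]; first exact: ltW.
have := e2 i; rewrite !ffunE => /(congr1 val) /=.
have cell (v : 'rV[R]_b) : `|v| <= N%:R ->
    0 <= (v 0 i + N%:R) / eta /\ (Num.truncn ((v 0 i + N%:R) / eta)%R < M.+1)%N.
  move=> vN; have := le_trans (rV_coord_le v i) vN; rewrite ler_norml => /andP[v1 v2].
  have v0 : 0 <= (v 0 i + N%:R) / eta by rewrite divr_ge0 ?(ltW eta0) //; lra.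
  split=> //; rewrite ltnS; apply: le_truncn.
  by rewrite ler_wpM2r ?invr_ge0 ?(ltW eta0) // natrM; lra.
have [cx cx'] := cell _ x2; have [cy cy'] := cell _ y2.
rewrite !inordK // => e.
have := truncn_itv cx; have := truncn_itv cy; rewrite e.
rewrite !ler_pdivlMr ?ltr_pdivrMr // -natr1 !mxE ler_norml.
move=> /andP[h1 h2] /andP[h3 h4].
nra.
Qed.

Section UniformDistance.
Variables (R : realType) (X : cfr_nilspace2 R) (P : free_presentation X).
Variable g : riemannian_metric P.
Local Notation F := (free2 R (fp_a1 P) (fp_b1 P) (fp_a2 P) (fp_b2 P)).
Local Notation n := (fp_b1 P + fp_b2 P)%N.
Local Notation V := 'rV[R]_n.
Local Notation pr := (@fp_proj R X P).

(** Only finitely many integer parts occur; for each, the tensor entries are continuous on a compact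
    ball of real parts. The sum of the resulting bounds serves for all. *)
Lemma tensor_bounded N : exists2 m : R, 0 <= m & forall p : F,
  coord_bounded N p.1 -> coord_bounded N p.2 -> forall i j, `|rm_tensor g p i j| <= m.
Proof.
pose T := ({ffun 'I_(fp_a1 P) -> 'I_(2 * N).+1} * {ffun 'I_(fp_a2 P) -> 'I_(2 * N).+1}
  * ('I_n * 'I_n))%type.
pose base (t : T) : F := ((int_box t.1.1, 0), (int_box t.1.2, 0)).
have /choice[m mP] : forall t : T, exists m, forall u : V, `|u| <= N%:R ->
    `|rm_tensor g (free_shift (base t) u) t.2.1 t.2.2| <= m.
  move=> t; pose B := [set u : V | `|u| <= N%:R].
  have Bc : compact B.
    apply: bounded_closed_compact.
      exists N%:R; split; first exact: num_real.
      by move=> x Nx u /= uN; apply: le_trans uN (ltW Nx).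
    rewrite (_ : B = (fun u : V => `|u|) @^-1` [set x | x <= N%:R]) //.
    by apply: closed_comp; [move=> u _; exact: norm_continuous | exact: closed_le].
  have Tc : compact ((fun u => rm_tensor g (free_shift (base t) u) t.2.1 t.2.2) @` B).
    by apply: continuous_compact Bc; apply: continuous_subspaceT; exact: tensor_continuous.
  have [m [_ mP]] := compact_bounded Tc.
  exists (m + 1) => u uN; apply: (mP (m + 1)); first by rewrite ltrDl.
  by exists u.
exists (\sum_t `|m t|); first exact: sumr_ge0.
move=> [[k1 x1] [k2 x2]] [/= /int_box_surj[f1 ->] x1N] [/= /int_box_surj[f2 ->] x2N] i j.
have := mP (f1, f2, (i, j)) (row_mx x1 x2) (row_mx_norm_le x1N x2N).
rewrite /free_shift /= row_mxKl row_mxKr !add0r => /le_trans; apply.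
by apply: le_trans (ler_norm _) _; rewrite (bigD1 (f1, f2, (i, j))) //= lerDl sumr_ge0.
Qed.

(** A segment of length at most 1 stays in the box of size [N + 1], where the tensor is bounded. *)
Lemma rdist_shift_le N : exists2 c : R, 0 <= c & forall (p : F) (u : V),
  coord_bounded N p.1 -> coord_bounded N p.2 -> `|u| <= 1 ->
  rdist g (pr p) (pr (free_shift p u)) <= c * `|u|.
Proof.
have [m m0 mP] := tensor_bounded (N + 1).
exists (Num.sqrt m * n%:R); first by rewrite mulr_ge0 ?sqrtr_ge0.
move=> p u p1 p2 u1; apply: rdist_line => // t /andP[t0 t1].
have tu : `|t *: u| <= 1%:R.
  by rewrite normrZ ger0_norm // mulr_ile1.
apply: mP; apply: coord_bounded_addreal => //.
  exact: le_trans (lsubmx_norm_le _) tu.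
exact: le_trans (rsubmx_norm_le _) tu.
Qed.

End UniformDistance.

(** * Colouring the translates *)

Lemma normC_cnorm (R : realType) (z : R[i]) : `|z| = (cnorm z)%:C%C.
Proof. by case: z. Qed.

Lemma cnormM (R : realType) (x y : R[i]) : cnorm (x * y) = cnorm x * cnorm y.
Proof. exact: Normc.normcM. Qed.

Lemma cnorm_ge0 (R : realType) (x : R[i]) : 0 <= cnorm x.
Proof. by rewrite -lecR -normC_cnorm normr_ge0. Qed.

Lemma cnorm_conj (R : realType) (x : R[i]) : cnorm x^* = cnorm x.
Proof. by apply: complexI; rewrite -!normC_cnorm norm_conjC. Qed.

Lemma cnormD (R : realType) (x y : R[i]) : cnorm (x + y) <= cnorm x + cnorm y.
Proof. exact: le_normcD. Qed.

Lemma cnorm_mul_conj_sub (R : realType) (a a' b b' : R[i]) :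
  cnorm a <= 1 -> cnorm b' <= 1 ->
  cnorm (a * b^* - a' * b'^*) <= cnorm (a - a') + cnorm (b - b').
Proof.
move=> a1 b1.
have -> : a * b^* - a' * b'^* = a * (b - b')^* + (a - a') * b'^*.
  by rewrite rmorphB /=; ring.
apply: le_trans (cnormD _ _) _; rewrite !cnormM !cnorm_conj addrC; apply: lerD.
  by rewrite ler_piMr ?cnorm_ge0.
by rewrite ler_piMl ?cnorm_ge0.
Qed.

Lemma nbhs0_free_group (R : realType) a b (U : set (free_group R a b)) : nbhs 0 U ->
  exists2 e : R, 0 < e & forall x, x.1 = 0 -> `|x.2| <= e -> U x.
Proof.
move=> [[A B] /= [A0 B0] AB].
have /nbhs_ballP[e /= e0 eB] := B0.
exists (e / 2) => [|[k v] /= -> vE]; first by rewrite divr_gt0.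
apply: AB; split=> /=; first exact: nbhs_singleton A0.
apply: eB; rewrite mx_norm_ball /ball_ /= sub0r normrN.
by apply: le_lt_trans vE _; rewrite ltr_pdivrMr // ltr_pMr // ltr1n.
Qed.

Section Translates.
Variables (R : realType) (X : cfr_nilspace2 R) (P : free_presentation X).
Variable g : riemannian_metric P.
Local Notation F := (free2 R (fp_a1 P) (fp_b1 P) (fp_a2 P) (fp_b2 P)).
Local Notation pr := (@fp_proj R X P).

Lemma translates_coloring :
  exists (D : nat) (A c eta0 : R), [/\ 0 < A, 0 <= c, 0 < eta0 <= 1 &
  forall (f : X -> R[i]) (chi : cfr_Z2 X -> R[i]) (L : R),
    is_character chi -> (forall x, cnorm (f x) <= 1) ->
    lipschitz_bounds (rdist g) f L -> vertical_frequency chi f ->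
  forall eta : R, 0 < eta <= eta0 ->
  forall (Z : finZmodType) (phi : Z -> X),
    nil_morphism (Dcubes 1 (A := Z)) (cfr_cubes X) phi ->
  forall h : Z, exists (T : finType) (col : Z -> T),
    #|T|%:R <= A * eta ^- D /\
    forall y y', col y = col y' -> forall z,
      cnorm (Delta h (f \o phi) (z + y') - Delta h (f \o phi) (z + y))
        <= 2 * L * c * eta].
Proof.
have [K1 K1c K1P] := fundamental_domain1 P.
have [K2 K2c K2P] := fundamental_domain2 P.
have [U U0 UP] := lattice1_discrete P.
have [e0 e00 e0P] := nbhs0_free_group U0.
have [N1 N1P] := compact_coord_bounded K1c.
have [N2 N2P] := compact_coord_bounded K2c.
pose N := maxn N1 N2.
have K1N x : K1 x -> coord_bounded N x.
  by move=> /N1P; apply: coord_boundedW; exact: leq_maxl.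
have K2N x : K2 x -> coord_bounded N x.
  by move=> /N2P; apply: coord_boundedW; exact: leq_maxr.
(* Three times [N], since [w1.1] will be [q.1 - p.1 + w0.1] with all three terms in [K1]. *)
have [c c0 cP] := rdist_shift_le g (N + N + N).
pose a1 := fp_a1 P; pose b1 := fp_b1 P; pose a2 := fp_a2 P; pose b2 := fp_b2 P.
pose W : R := (2 * N).+1%:R.
(* The exponent counts the real coordinates of [p.1], [q.1] and [q.2 - p.2]. The bound [e0 / 2] lets
   a difference of two errors of size [eta] fall in [U]. *)
exists (b1 + b1 + b2)%N, (W ^+ (a1 + b1) * W ^+ (a1 + b1) * W ^+ (a2 + b2)), c,
  (Num.min (e0 / 2) 1).
split=> //.
- by rewrite !mulr_gt0 ?exprn_gt0.
- by rewrite lt_min divr_gt0 // ltr01 ge_min lexx orbT.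
move=> f chi L [chiD chi1] f1 [L0 fL] fchi eta /andP[eta0 eta_le] Z phi phiP h.
have [eta_e eta_1] : eta <= e0 / 2 /\ eta <= 1.
  by move: eta_le; rewrite le_min => /andP.
have /choice[pq pqP] : forall y, exists pq : F * F,
    [/\ pr pq.1 = phi y, pr pq.2 = phi (y + h), K1 pq.1.1, K1 pq.2.1 &
        K2 (pq.2.2 - pq.1.2)].
  move=> y; have [p0 p0E] := fp_surj P (phi y); have [q0 q0E] := fp_surj P (phi (y + h)).
  have [p pE Kp] := K1P p0; have [q qE Kq] := K1P q0.
  have [t Kt tE] := K2P (q.2 - p.2).
  exists (p, (q.1, q.2 + t)); split=> //=; rewrite ?pE ?tE ?qE //.
  by rewrite addrAC.
have eta01 : 0 < eta <= 1 by rewrite eta0.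
have [T1 [col1 [cT1 col1P]]] := @grid_coloring R a1 b1 N eta eta01.
have [T2 [col2 [cT2 col2P]]] := @grid_coloring R a2 b2 N eta eta01.
exists (T1 * T1 * T2)%type, (fun y => (col1 (pq y).1.1, col1 (pq y).2.1,
  col2 ((pq y).2.2 - (pq y).1.2))); split.
  rewrite !card_prod !natrM.
  have -> : W ^+ (a1 + b1) * W ^+ (a1 + b1) * W ^+ (a2 + b2) * eta ^- (b1 + b1 + b2) =
    (W ^+ (a1 + b1) * eta ^- b1) * (W ^+ (a1 + b1) * eta ^- b1) * (W ^+ (a2 + b2) * eta ^- b2).
    by rewrite -!exprVn !exprD; ring.
  by do 2?apply: ler_pM; rewrite ?mulr_ge0.
move=> y y' [cp cq cr] z.
case: (pq y) (pqP y) cp cq cr => p q /= [pE qE Kp Kq Kr].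
case: (pq y') (pqP y') => p' q' /= [p'E q'E Kp' Kq' Kr'] cp cq cr.
have [p1 p2] := col1P _ _ (K1N _ Kp) (K1N _ Kp') cp.
have [q1 q2] := col1P _ _ (K1N _ Kq) (K1N _ Kq') cq.
have [r1 r2] := col2P _ _ (K2N _ Kr) (K2N _ Kr') cr.
have Uq : U (q'.1 - (p'.1 - p.1 + q.1)).
  apply: e0P; first by rewrite /= p1 q1 subrr add0r subrr.
  rewrite /= (_ : _ - _ = (p.1.2 - p'.1.2) - (q.1.2 - q'.1.2)); last first.
    by apply/rowP => i; rewrite !mxE; ring.
  apply: le_trans (ler_normB _ _) _; lra.
have [w0 [w1 [r [[Kw0 w1E] w0z w1z w0z' w1z']]]] :=
  lift_parallelepiped z K1P UP phiP pE qE p'E q'E Uq.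
have [t0 Kt0 t0E] := K2P w0.2; have [t1 Kt1 t1E] := K2P w1.2.
pose v0 : F := (w0.1, w0.2 + t0); pose v1 : F := (w1.1, w1.2 + t1).
(* Up to [r], the edges above [y + z] and [y + z + h] have real displacements [s0] and [s1] and no
   integer displacement. *)
pose e1 : 'rV[R]_b1 := p'.1.2 - p.1.2.
pose e2 : 'rV[R]_b2 := (q'.2.2 - q.2.2) - (p'.2.2 - p.2.2).
pose s0 := row_mx e1 (0 : 'rV[R]_b2); pose s1 := row_mx e1 e2.
have e1_eta : `|e1| <= eta by rewrite distrC.
have e2_eta : `|e2| <= eta.
  rewrite -normrN (_ : - e2 = (q.2 - p.2).2 - (q'.2 - p'.2).2) //.
  by rewrite /e2 /=; apply/rowP => i; rewrite !mxE; ring.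
have s0_eta : `|s0| <= eta by apply: row_mx_norm_le; rewrite // normr0 ltW.
have s1_eta : `|s1| <= eta by apply: row_mx_norm_le.
have N3 : (N <= N + N + N)%N by rewrite -addnA leq_addr.
have v0N : coord_bounded (N + N + N) v0.1 /\ coord_bounded (N + N + N) v0.2.
  by split; apply: (coord_boundedW N3); [apply: K1N|apply: K2N].
have v1N : coord_bounded (N + N + N) v1.1 /\ coord_bounded (N + N + N) v1.2.
  split; last by apply: (coord_boundedW N3); apply: K2N.
  rewrite /v1 /= w1E; apply: (coord_boundedD _ (K1N _ Kw0)).
  by apply: (coord_boundedD (K1N _ Kq)); apply: coord_boundedN; apply: K1N.
have near v s : coord_bounded (N + N + N) v.1 /\ coord_bounded (N + N + N) v.2 ->
    `|s| <= eta -> cnorm (f (pr (free_shift v s)) - f (pr v)) <= L * c * eta.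
  move=> [vN1 vN2] s_eta; rewrite -opprB /cnorm normcN -/(cnorm _).
  apply: le_trans (fL _ _) _; rewrite -mulrA ler_wpM2l //.
  apply: le_trans (cP _ _ vN1 vN2 (le_trans s_eta eta_1)) _.
  by rewrite ler_wpM2l.
have shift0 : pr ((free_shift v0 s0).1, (free_shift v0 s0).2 + r) = phi (y' + z).
  rewrite -w0z' -(t0E (p'.1 - p.1 + w0.1, r + w0.2)) /free_shift row_mxKl row_mxKr /=.
  congr (pr (_, _)); apply/pair_equal_spec; split => /=.
  - by rewrite p1 subrr add0r.
  - by rewrite addrC.
  - by rewrite addrC addrA.
  - by rewrite addr0 addrC addrA.
have shift1 : pr ((free_shift v1 s1).1, (free_shift v1 s1).2 + r) = phi (y' + z + h).
  rewrite -w1z' -(t1E (p'.1 - p.1 + w1.1,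
    q'.2 - q.2 - (p'.2 - p.2) + r + w1.2)) /free_shift row_mxKl row_mxKr /=.
  congr (pr (_, _)); apply/pair_equal_spec; split => /=.
  - by rewrite p1 subrr add0r.
  - by rewrite addrC.
  - have -> : q'.2.1 - q.2.1 - (p'.2.1 - p.2.1) = 0.
      have r1' : q.2.1 - p.2.1 = q'.2.1 - p'.2.1 by exact: r1.
      have -> : q'.2.1 = q.2.1 + (p'.2.1 - p.2.1) by rewrite addrCA r1' addrC subrK.
      by rewrite addrAC addrK subrr.
    by rewrite add0r addrC addrA.
  - rewrite /e2; set d := _ - _ - _.
    by rewrite [RHS](ACl (3*4*1*2)).
(* The uncontrolled shift [r] is common to both edges, hence acts through a single [zz]; the factor
   [chi zz], of modulus 1, cancels in [Delta]. *)
have [zz zzE] := vertical_shift r (fun b => if b then free_shift v1 s1 else free_shift v0 s0).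
have fy0 : f (phi (y' + z)) = chi zz * f (pr (free_shift v0 s0)).
  by rewrite -shift0 (zzE false) fchi.
have fy1 : f (phi (y' + z + h)) = chi zz * f (pr (free_shift v1 s1)).
  by rewrite -shift1 (zzE true) fchi.
rewrite /Delta /= ![z + _]addrC fy0 fy1 -w0z -w1z -(t0E w0) -(t1E w1) -/v0 -/v1.
rewrite rmorphM /= mulrACA -normCK normC_cnorm chi1 expr1n mul1r.
apply: le_trans (cnorm_mul_conj_sub _ _ _ _) _ => //.
rewrite (_ : 2 * L * c * eta = L * c * eta + L * c * eta); last by ring.
by apply: lerD; apply: near.
Qed.

End Translates.

(** * Conclusion *)

Lemma pigeonhole_class (S T : finType) (col : S -> T) (s0 : S) :
  exists t, (#|S| <= #|T| * #|[set s | col s == t]%SET|)%N.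
Proof.
pose t := [arg max_(t > col s0) #|[set s | col s == t]%SET|]%N.
exists t; rewrite -[leqLHS]sum1_card [leqLHS](partition_big col predT) //=.
apply: (@leq_trans (\sum_(t' : T) #|[set s | col s == t]%SET|)%N); last first.
  by rewrite sum_nat_const.
apply: leq_sum => t' _; rewrite sum1dep_card /t; case: arg_maxnP => //= t1 _ /(_ t'); exact.
Qed.

(** The infimum is attained: at distance 0 any admissible constant forces equality, and at positive
    distance one divides by it. *)
Lemma norm_lip_bounds (R : realType) (X : Type) (d : X -> X -> R) (f : X -> R[i]) :
  (forall x y, 0 <= d x y) -> is_lipschitz d f -> lipschitz_bounds d f (norm_lip d f).
Proof.
move=> d0 fL; split; first by apply: lb_le_inf => // L [].
move=> x y; have := d0 x y; rewrite le_eqVlt => /orP[/eqP d00|d_gt0].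
  by have [L [_ /(_ x y)]] := fL; rewrite -d00 !mulr0.
rewrite -ler_pdivrMr //; apply: lb_le_inf => // L [_ /(_ x y)].
by rewrite ler_pdivrMr.
Qed.

Theorem theorem4p18 (R : realType) (X : cfr_nilspace2 R)
    (P : free_presentation X) (g : riemannian_metric P) :
  exists (D : nat) (C : R -> R),
  forall (F : X -> R[i]) (chi : cfr_Z2 X -> R[i]),
    is_character chi -> cts chi ->
    (forall x, cnorm (F x) <= 1) -> cts F -> is_lipschitz (rdist g) F ->
    vertical_frequency chi F ->
  forall (sigma : R), 0 < sigma < 1 / 2 ->
  forall (Z : finZmodType) (phi : Z -> X),
    nil_morphism (Dcubes 1 (A := Z)) (cfr_cubes X) phi ->
  forall h : Z,
  exists (S : {fset {ffun Z -> R[i]}}) (lambda : {ffun Z -> R[i]} -> R[i])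
         (E : Z -> R[i]),
    [/\ forall z : Z, Delta h (F \o phi) z =
          \sum_(gamma <- S) lambda gamma * gamma z + E z,
        forall gamma, gamma \in S -> is_character (gamma : Z -> R[i]),
        (#|` S|)%:R <= C (norm_sum (rdist g) F) * sigma ^- D,
        norm_sup E <= sigma &
        forall gamma, gamma \in S -> cnorm (lambda gamma) <= norm_sup F ^+ 2].
Proof.
have [D [A [c [eta0 [A0 c0 /andP[eta00 eta01] HD]]]]] := translates_coloring g.
(* With [eta = kappa * sigma / (1 + Mn)] and Lipschitz constant at most [1 + Mn], this makes the
   error [2 * L * c * eta] at most [sigma / 2]; [c + 1] keeps the denominator positive. *)
pose kappa := Num.min eta0 (4 * (c + 1))^-1.
have c1 : 0 < 4 * (c + 1) by lra.
have kappa0 : 0 < kappa by rewrite lt_min eta00 invr_gt0.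
(* This is [delta ^- 2] for [delta = sigma / (2 * A * eta ^- D)], with [eta] expanded: [eta]
   contributes [2D] powers of [sigma] and [delta] two more. *)
exists (2 * D + 2)%N, (fun M => 4 * (A * kappa ^- D * (1 + M) ^+ D) ^+ 2).
move=> F chi chiP _ F1 _ FL Fchi sigma /andP[sigma0 sigma1] Z phi phiP h.
pose Mn := norm_sum (rdist g) F; rewrite -/Mn.
have [L0 FLb] := norm_lip_bounds (@rdist_ge0 _ _ _ g) FL.
have Fub x : cnorm (F x) <= norm_sup F.
  by apply: ub_le_sup; [exists 1 => _ [y _ <-] | exists x].
have Fsup0 : 0 <= norm_sup F by apply: le_trans (cnorm_ge0 _) (Fub (phi 0)).
have Fsup1 : norm_sup F <= 1.
  by apply: ge_sup; [exists (cnorm (F (phi 0))), (phi 0) | move=> _ [y _ <-]].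
have Mn0 : 0 < 1 + Mn by rewrite /Mn /norm_sum; lra.
have LMn : norm_lip (rdist g) F <= 1 + Mn by rewrite /Mn /norm_sum; lra.
pose eta := kappa * sigma / (1 + Mn).
have eta_gt0 : 0 < eta by rewrite divr_gt0 // mulr_gt0.
have eta_le : eta <= eta0.
  rewrite ler_pdivrMr // ; apply: (@le_trans _ _ (kappa * 1)).
    by rewrite ler_wpM2l ?(ltW kappa0) //; lra.
  apply: ler_pM; rewrite ?(ltW kappa0) // ?ge_min ?lexx //.
  by rewrite /Mn /norm_sum; lra.
have eta_eps : 2 * norm_lip (rdist g) F * c * eta <= sigma / 2.
  have kc : kappa * (4 * (c + 1)) <= 1.
    by rewrite -ler_pdivlMr // mul1r ge_min lexx orbT.
  have Lk : norm_lip (rdist g) F * eta <= kappa * sigma.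
    rewrite /eta mulrA ler_pdivrMr // mulrC.
    by rewrite ler_wpM2l // ltW // mulr_gt0.
  have : kappa * c <= 1 / 4 by nra.
  have := c0; nra.
have etaP : 0 < eta <= eta0 by rewrite eta_gt0.
have [T [col [cT colP]]] := HD F chi _ chiP F1 (conj L0 FLb) Fchi eta etaP Z phi phiP h.
have [t tP] := pigeonhole_class col 0.
pose B := [set s | col s == t]%SET.
pose NT := A * eta ^- D.
have NT0 : 0 < NT by rewrite mulr_gt0 // invr_gt0 exprn_gt0.
(* The largest colour class satisfies [#|Z| / #|B| <= #|T| <= NT], so the truncation error
   [delta * (#|Z| / #|B|)] is at most [sigma / 2]. *)
pose delta := sigma / (2 * NT).
have delta0 : 0 < delta by rewrite divr_gt0 // mulr_gt0.
have B0 : B != finset.set0.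
  rewrite -card_gt0 lt0n; apply: contraTneq tP => B0.
  by rewrite -/B B0 muln0 -ltnNge; apply/card_gt0P; exists 0.
pose f := Delta h (F \o phi).
have fM z : `|f z| <= ((norm_sup F ^+ 2)%:C)%C.
  rewrite normC_cnorm lecR /f /Delta cnormM cnorm_conj expr2.
  by apply: ler_pM; rewrite ?cnorm_ge0 ?Fub.
have feps b b' : b \in B -> b' \in B -> forall z,
    `|f (z + b) - f (z + b')| <= ((sigma / 2)%:C)%C.
  rewrite !inE => /eqP eb /eqP eb' z; rewrite normC_cnorm lecR.
  by apply: le_trans eta_eps; apply: colP; rewrite eb eb'.
have delta0C : 0 < (delta%:C)%C :> R[i] by rewrite ltcR.
have [S [lambda [Su Sc Ssize Slambda Sf]]] := fourier_truncation fM delta0C B0 feps.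
exists [fset gamma in S]%fset, lambda,
  (fun z => f z - \sum_(gamma <- S) lambda gamma * gamma z).
have sumS z : \sum_(gamma <- [fset gamma in S]%fset) lambda gamma * gamma z =
    \sum_(gamma <- S) lambda gamma * gamma z.
  apply: perm_big; apply: uniq_perm => //.
  by move=> gamma; rewrite inE.
split.
- by move=> z; rewrite sumS addrC subrK.
- move=> gamma; rewrite inE => /Sc[gM g1]; split=> // x.
  by apply: complexI; rewrite -normC_cnorm g1.
- rewrite card_fseq undup_id //.
  have : (size S)%:R <= (norm_sup F ^+ 2) ^+ 2 / delta ^+ 2.
    by rewrite -!rmorphXn -fmorph_div -(rmorph_nat (real_complex R)) lecR in Ssize.
  move/le_trans; apply.
  apply: (@le_trans _ _ (1 / delta ^+ 2)).
    by rewrite ler_wpM2r ?invr_ge0 ?exprn_ge0 ?(ltW delta0) // !exprn_ile1 // exprn_ge0.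
  rewrite le_eqVlt; apply/orP; left; apply/eqP.
  rewrite /delta /NT /eta (expr_div_n _ _ D) (exprMn D).
  rewrite (_ : 2 * D + 2 = D + D + 2)%N; last by rewrite mul2n -addnn.
  rewrite !(exprD sigma). field.
  by rewrite !gt_eqF ?exprn_gt0.
- apply: ge_sup; first by exists (cnorm (f 0 - \sum_(gamma <- S) lambda gamma * gamma 0)), 0.
  move=> _ [z _ <-].
  rewrite -lecR -normC_cnorm; apply: le_trans (Sf z) _.
  apply: (@le_trans _ _ ((sigma / 2 + delta * NT)%:C)%C); last first.
    by rewrite lecR le_eqVlt /delta; apply/orP; left; apply/eqP; field; rewrite gt_eqF.
  rewrite rmorphD /= lerD2l (rmorphM (real_complex R) delta NT) /= ler_wpM2l ?(ltW delta0C) //.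
  rewrite ler_pdivrMr ?ltr0n ?card_gt0 // -[X in _ * X](rmorph_nat (real_complex R)).
  rewrite -rmorphM /= -(rmorph_nat (real_complex R)) lecR.
  apply: le_trans (_ : (#|T| * #|B|)%:R <= _); first by rewrite ler_nat.
  by rewrite natrM ler_wpM2r.
- by move=> gamma; rewrite inE => /Slambda; rewrite normC_cnorm lecR.
Qed.
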